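(* There exist linear operators $\mathcal{D},\mathcal{L}:\mathbb{C}[u,\mathbf{v}]\to\mathbb{C}[u,\mathbf{v}]$ such that, setting $\mathcal{D}_N=\mathcal{D}-\frac{1}{N^2}\mathcal{L}$, we have $\Delta_N(p_N)=(\mathcal{D}_Np)_N$ for all $N\ge1$ and all $p\in\mathbb{C}[u,\mathbf{v}]$. Moreover $\mathcal{D}$ is the unique linear operator on $\mathbb{C}[u,\mathbf{v}]$ satisfying: (1) $\mathcal{D}(u^k)=-ku^k-2\sum_{m=1}^{k-1}mu^mv_{k-m}$ for all $k\ge1$; (2) $\mathcal{D}(v_k)=-kv_k-2\sum_{m=1}^{k-1}mv_mv_{k-m}$ for all $k\ge1$; (3) $\mathcal{D}(pq)=\mathcal{D}(p)q+p\mathcal{D}(q)$ for all $p,q\in\mathbb{C}[u,\mathbf{v}]$ such that $p$ or $q$ is scalar.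
   Context: $\mathbb{C}[u,\mathbf{v}]$ is the polynomial algebra over $\mathbb{C}$ in one indeterminate $u$ and infinitely many indeterminates $\mathbf{v}=(v_1,v_2,\dots)$ (each element involves finitely many of them); $p$ is scalar if it does not depend on $u$. For $p\in\mathbb{C}[u,\mathbf{v}]$ and $N\ge1$, $p_N:U(N)\to M_N(\mathbb{C})$ is $p_N(U)=p(U,\mathrm{tr}(U),\mathrm{tr}(U^2),\dots)$, i.e. substitute $u=U$, $v_j=\mathrm{tr}(U^j)I$, where $\mathrm{tr}=\frac1N\mathrm{Trace}$. $\Delta_N=\sum_j\tilde X_j^2$ for an orthonormal basis of $u(N)$ with respect to $\langle X,Y\rangle_N=N\,\mathrm{Re}\,\mathrm{Trace}(X^*Y)$, $(\tilde Xf)(U)=\frac{d}{ds}f(Ue^{sX})|_{s=0}$, acting entrywise. *)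

(* Defs.v *)
From Stdlib Require Import Reals List Arith ClassicalEpsilon.
Import ListNotations.
Open Scope R_scope.

Definition C := (R * R)%type.
Definition C0 : C := (0, 0).
Definition C1 : C := (1, 0).
Definition RtoC (r : R) : C := (r, 0).
Definition Cadd (a b : C) : C := (fst a + fst b, snd a + snd b).
Definition Cmul (a b : C) : C :=
  (fst a * fst b - snd a * snd b, fst a * snd b + snd a * fst b).
Definition Copp (a : C) : C := (- fst a, - snd a).
Definition Cconj (a : C) : C := (fst a, - snd a).
Definition Csum (l : list C) : C := fold_right Cadd C0 l.
Fixpoint Cpow (a : C) (n : nat) : C :=
  match n with O => C1 | S n => Cmul a (Cpow a n) end.

(* ---------- N x N complex matrices (only indices < N matter) ---------- *)
Definition Mat := nat -> nat -> C.
Definition mzero : Mat := fun _ _ => C0.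
Definition mid : Mat := fun i j => if Nat.eqb i j then C1 else C0.
Definition mmul (N : nat) (A B : Mat) : Mat :=
  fun i j => Csum (map (fun k => Cmul (A i k) (B k j)) (seq 0 N)).
Definition madd (A B : Mat) : Mat := fun i j => Cadd (A i j) (B i j).
Definition mscale (c : C) (A : Mat) : Mat := fun i j => Cmul c (A i j).
Definition madj (A : Mat) : Mat := fun i j => Cconj (A j i).
Fixpoint mpow (N : nat) (A : Mat) (k : nat) : Mat :=
  match k with O => mid | S k => mmul N A (mpow N A k) end.
Definition mtrace (N : nat) (A : Mat) : C := Csum (map (fun i => A i i) (seq 0 N)).
Definition ntr (N : nat) (A : Mat) : C := Cmul (RtoC (/ INR N)) (mtrace N A).

Definition unitary (N : nat) (U : Mat) : Prop :=
  forall i j, (i < N)%nat -> (j < N)%nat ->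
    mmul N (madj U) U i j = mid i j /\ mmul N U (madj U) i j = mid i j.

Fixpoint exp_partial (N : nat) (X : Mat) (n : nat) : Mat :=
  match n with
  | O => mid
  | S n' => madd (exp_partial N X n') (mscale (RtoC (/ INR (fact n))) (mpow N X n))
  end.
Definition is_expm (N : nat) (X E : Mat) : Prop :=
  forall i j, (i < N)%nat -> (j < N)%nat ->
    Un_cv (fun n => fst (exp_partial N X n i j)) (fst (E i j)) /\
    Un_cv (fun n => snd (exp_partial N X n i j)) (snd (E i j)).
Definition expm (N : nat) (X : Mat) : Mat :=
  epsilon (inhabits mzero) (is_expm N X).

Definition skew_hermitian (N : nat) (X : Mat) : Prop :=
  forall i j, (i < N)%nat -> (j < N)%nat -> X i j = Copp (Cconj (X j i)).
Definition inner (N : nat) (X Y : Mat) : R :=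
  INR N * fst (mtrace N (mmul N (madj X) Y)).
(* an orthonormal basis of u(N) (real dimension N^2) *)
Definition onb_uN (N : nat) (B : list Mat) : Prop :=
  length B = (N * N)%nat /\ Forall (skew_hermitian N) B /\
  forall a b, (a < N * N)%nat -> (b < N * N)%nat ->
    inner N (nth a B mzero) (nth b B mzero) = (if Nat.eqb a b then 1 else 0).

Definition rderiv (g : R -> R) (s : R) : R :=
  epsilon (inhabits 0) (fun l => derivable_pt_lim g s l).
Definition Xtilde (N : nat) (X : Mat) (f : Mat -> C) : Mat -> C :=
  fun U =>
    (rderiv (fun s => fst (f (mmul N U (expm N (mscale (RtoC s) X))))) 0,
     rderiv (fun s => snd (f (mmul N U (expm N (mscale (RtoC s) X))))) 0).
Definition Laplacian (N : nat) (B : list Mat) (F : Mat -> Mat) : Mat -> Mat :=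
  fun U i j => Csum (map (fun X => Xtilde N X (Xtilde N X (fun V => F V i j)) U) B).

(* An exponent list e encodes the monomial u^(e_0) v_1^(e_1) v_2^(e_2) ...
   (entries beyond the length are 0). A polynomial is a finite formal sum of
   terms; two polynomials are equal (peq) iff all their coefficients agree. *)
Definition expo := list nat.
Definition term := (C * expo)%type.
Definition cpoly := list term.

Fixpoint strip (e : expo) : expo :=
  match e with
  | [] => []
  | x :: l => match strip l with
              | [] => if Nat.eqb x 0 then [] else [x]
              | l' => x :: l'
              end
  end.
Definition expo_eqb (a b : expo) : bool :=
  if list_eq_dec Nat.eq_dec (strip a) (strip b) then true else false.
Definition coef (p : cpoly) (m : expo) : C :=
  Csum (map fst (filter (fun t => expo_eqb (snd t) m) p)).
Definition peq (p q : cpoly) : Prop := forall m, coef p m = coef q m.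

Fixpoint eadd (a b : expo) : expo :=
  match a, b with
  | [], b => b
  | a, [] => a
  | x :: a', y :: b' => (x + y)%nat :: eadd a' b'
  end.
Definition padd (p q : cpoly) : cpoly := p ++ q.
Definition pscale (c : C) (p : cpoly) : cpoly := map (fun t => (Cmul c (fst t), snd t)) p.
Definition pmul (p q : cpoly) : cpoly :=
  flat_map (fun t1 => map (fun t2 => (Cmul (fst t1) (fst t2), eadd (snd t1) (snd t2))) q) p.
Definition psum (l : list cpoly) : cpoly := concat l.
Definition pu (k : nat) : cpoly := [(C1, [k])].
Definition pv (k : nat) : cpoly := [(C1, repeat 0%nat k ++ [1%nat])].
Definition scalar (p : cpoly) : Prop :=
  forall m, nth 0 m 0%nat <> 0%nat -> coef p m = C0.

(* p_N(U) = p(U, tr(U), tr(U^2), ...) *)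
Definition tprod (N : nat) (U : Mat) (e : expo) : C :=
  fold_right Cmul C1
    (map (fun j => Cpow (ntr N (mpow N U j)) (nth j e 0%nat)) (seq 1 (length e - 1))).
Definition peval (N : nat) (p : cpoly) (U : Mat) : Mat :=
  fun i k => Csum (map (fun t =>
    Cmul (Cmul (fst t) (tprod N U (snd t))) (mpow N U (nth 0 (snd t) 0%nat) i k)) p).

Definition plinear (D : cpoly -> cpoly) : Prop :=
  (forall p q, peq p q -> peq (D p) (D q)) /\
  (forall p q, peq (D (padd p q)) (padd (D p) (D q))) /\
  (forall c p, peq (D (pscale c p)) (pscale c (D p))).

Definition DN (N : nat) (D L : cpoly -> cpoly) (p : cpoly) : cpoly :=
  padd (D p) (pscale (RtoC (- / (INR N * INR N))) (L p)).

Definition D_props (D : cpoly -> cpoly) : Prop :=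
  (forall k, (1 <= k)%nat ->
     peq (D (pu k))
       (padd (pscale (RtoC (- INR k)) (pu k))
          (pscale (RtoC (-2))
             (psum (map (fun m => pscale (RtoC (INR m)) (pmul (pu m) (pv (k - m))))
                        (seq 1 (k - 1))))))) /\
  (forall k, (1 <= k)%nat ->
     peq (D (pv k))
       (padd (pscale (RtoC (- INR k)) (pv k))
          (pscale (RtoC (-2))
             (psum (map (fun m => pscale (RtoC (INR m)) (pmul (pv m) (pv (k - m))))
                        (seq 1 (k - 1))))))) /\
  (forall p q, scalar p \/ scalar q ->
     peq (D (pmul p q)) (padd (pmul (D p) q) (pmul p (D q)))).

(* Main.v *)
From Stdlib Require Import Reals List Arith Lia Lra Permutation Setoid Morphisms Ring.
From Stdlib Require Import ClassicalEpsilon FunctionalExtensionality.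
From Coquelicot Require Import Rbar Lim_seq Hierarchy Derive PSeries.
Require Import Defs.
Import ListNotations.
Open Scope R_scope.

(** Summing [X i j * X k l] over an orthonormal basis of u(N) gives
    [- (1/N) delta_il delta_jk], hence [sum_X A X M X K = - tr(M) A K] and
    [sum_X tr(X M) X = - (1/N^2) M].  Differentiating
    [tr(U^(j_1)) ... tr(U^(j_r)) U^k] twice along [U e^(sX)], every term in which
    both derivatives hit the same factor is evaluated by the first identity and
    gives the first-order operator D; every term in which they hit different factors
    contains a trace [tr(X U^j)], and by the second identity contributes to
    [- (1/N^2) L]. *)

(** A polynomial is a list of terms known only through its coefficients, so trailing zeros in
    exponents, repeated monomials and cancelling terms must all be invisible to the operators.
    Identities modulo [peq] are therefore tested against the linear functionals [lin phi] with [phi]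
    blind to trailing zeros; coefficients and entries of the evaluation at a matrix are both of this
    kind.

    The operator D is not a derivation: the terms m u^m v_(k-m) arise when the two derivatives hit
    different letters of the same word U^k and close up a trace between them. Hence u^k is treated
    as one indivisible block and the v_j as separate factors. A product rule with one scalar factor
    still determines D, because every monomial is a block u^k times scalar factors.

    Both [expm] and [rderiv] are choices made by [epsilon], so the existence of each limit has to be
    proved before its value can be used. Moreover [onb_uN] supplies only orthonormality and the
    count N^2, whereas the basis identities express completeness; a trace argument for a projection
    closes this gap. *)

Lemma C_ext (a b : C) : fst a = fst b -> snd a = snd b -> a = b.
Proof. destruct a, b; simpl; intros; subst; reflexivity. Qed.

Lemma C_ring_theory :
  ring_theory C0 C1 Cadd Cmul (fun a b => Cadd a (Copp b)) Copp eq.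
Proof. constructor; intros; apply C_ext; simpl; ring. Qed.

Add Ring C_ring : C_ring_theory.

(** * Finite sums of complex numbers *)

Notation "'Sum' ( x 'in' l ) e" := (Csum (map (fun x => e) l))
  (at level 45, x name, l at level 200, e at level 45).

Section FiniteSums.
Context {S T : Type}.
Implicit Types (f g : T -> C) (l : list T).

Lemma Csum_ext f g l :
  (forall x, In x l -> f x = g x) -> (Sum (x in l) f x) = (Sum (x in l) g x).
Proof.
  intros H; induction l as [|x l IH]; simpl; [reflexivity|].
  f_equal; [apply H; left; reflexivity|].
  apply IH; intros y Hy; apply H; right; exact Hy.
Qed.

Lemma Csum_app f l l' :
  (Sum (x in l ++ l') f x) = Cadd (Sum (x in l) f x) (Sum (x in l') f x).
Proof. induction l as [|x l IH]; simpl; [ring|rewrite IH; ring]. Qed.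

Lemma Csum_add f g l :
  (Sum (x in l) Cadd (f x) (g x)) = Cadd (Sum (x in l) f x) (Sum (x in l) g x).
Proof. induction l as [|x l IH]; simpl; [ring|rewrite IH; ring]. Qed.

Lemma Csum_mul_l c f l :
  (Sum (x in l) Cmul c (f x)) = Cmul c (Sum (x in l) f x).
Proof. induction l as [|x l IH]; simpl; [ring|rewrite IH; ring]. Qed.

Lemma Csum_mul_r c f l :
  (Sum (x in l) Cmul (f x) c) = Cmul (Sum (x in l) f x) c.
Proof. induction l as [|x l IH]; simpl; [ring|rewrite IH; ring]. Qed.

Lemma Csum_zero l : (Sum (x in l) C0) = C0.
Proof. induction l as [|x l IH]; simpl; [reflexivity|rewrite IH; ring]. Qed.

Lemma Csum_exchange (f : S -> T -> C) (k : list S) l :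
  (Sum (y in k) Sum (x in l) f y x) = (Sum (x in l) Sum (y in k) f y x).
Proof.
  induction k as [|y k IH]; simpl; [symmetry; apply Csum_zero|].
  rewrite IH, <- Csum_add; reflexivity.
Qed.

Lemma Csum_one l : (Sum (x in l) C1) = RtoC (INR (length l)).
Proof.
  induction l as [|x l IH]; [reflexivity|].
  change (Cadd C1 (Sum (x in l) C1) = RtoC (INR (1 + length l))).
  rewrite IH, plus_INR; apply C_ext; simpl; ring.
Qed.

Lemma Csum_flat_map (g : S -> list T) f (k : list S) :
  (Sum (x in flat_map g k) f x) = (Sum (y in k) Sum (x in g y) f x).
Proof.
  induction k as [|y k IH]; simpl; [reflexivity|].
  rewrite Csum_app, IH; reflexivity.
Qed.

End FiniteSums.

Lemma Csum_seq_S (f : nat -> C) n :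
  (Sum (k in seq 0 (S n)) f k) = Cadd (Sum (k in seq 0 n) f k) (f n).
Proof. rewrite seq_S, Csum_app; simpl; ring. Qed.

Lemma Csum_seq_shift (f : nat -> C) n :
  (Sum (k in seq 0 (S n)) f k) = Cadd (f 0%nat) (Sum (k in seq 0 n) f (S k)).
Proof. simpl; rewrite <- seq_shift, map_map; reflexivity. Qed.

Lemma Csum_delta n (f : nat -> C) i :
  (i < n)%nat ->
  (Sum (k in seq 0 n) Cmul (if Nat.eqb i k then C1 else C0) (f k)) = f i.
Proof.
  intros Hi; induction n as [|n IH]; [lia|].
  rewrite Csum_seq_S.
  destruct (Nat.eq_dec i n) as [->|Hn].
  - rewrite Nat.eqb_refl.
    rewrite (Csum_ext _ (fun _ => C0)), Csum_zero; [ring|].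
    intros k Hk; apply in_seq in Hk.
    replace (Nat.eqb n k) with false by (symmetry; apply Nat.eqb_neq; lia); ring.
  - rewrite IH by lia.
    replace (Nat.eqb i n) with false by (symmetry; apply Nat.eqb_neq; lia); ring.
Qed.

(** * Polynomials modulo [peq] *)

Lemma nth_strip e j : nth j (strip e) 0%nat = nth j e 0%nat.
Proof.
  revert j; induction e as [|x l IH]; intros j; simpl; [reflexivity|].
  destruct (strip l) as [|y s] eqn:Hs.
  - assert (Hl : forall i, nth i l 0%nat = 0%nat)
      by (intros i; rewrite <- IH; destruct i; reflexivity).
    destruct (Nat.eqb_spec x 0) as [->|]; destruct j; simpl; rewrite ?Hl; try reflexivity.
    destruct j; reflexivity.
  - destruct j; [reflexivity|apply IH].
Qed.

Lemma strip_zero e : (forall j, nth j e 0%nat = 0%nat) -> strip e = [].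
Proof.
  induction e as [|x l IH]; intros H; simpl; [reflexivity|].
  rewrite IH by (intros j; exact (H (S j))).
  specialize (H 0%nat); simpl in H; subst x; reflexivity.
Qed.

Lemma strip_eq_iff a b :
  strip a = strip b <-> forall j, nth j a 0%nat = nth j b 0%nat.
Proof.
  split; [intros H j; rewrite <- (nth_strip a), H; apply nth_strip|].
  revert b; induction a as [|x a IH]; intros b H.
  - symmetry; apply strip_zero; intros j; rewrite <- H; destruct j; reflexivity.
  - destruct b as [|y b].
    + apply strip_zero; intros j; rewrite H; destruct j; reflexivity.
    + simpl; rewrite (IH b) by (intros j; exact (H (S j))).
      specialize (H 0%nat); simpl in H; subst y; reflexivity.
Qed.

Lemma nth_eadd a b j :
  nth j (eadd a b) 0%nat = (nth j a 0 + nth j b 0)%nat.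
Proof.
  revert b j; induction a as [|x a IH]; intros b j; simpl.
  - destruct j; reflexivity.
  - destruct b as [|y b]; [destruct j; simpl; lia|].
    destruct j; simpl; [reflexivity|apply IH].
Qed.

Lemma eadd_comm a b : eadd a b = eadd b a.
Proof.
  revert b; induction a as [|x a IH]; intros [|y b]; simpl; try reflexivity.
  rewrite IH; f_equal; lia.
Qed.

Lemma eadd_assoc a b c : eadd a (eadd b c) = eadd (eadd a b) c.
Proof.
  revert b c; induction a as [|x a IH]; intros [|y b] [|z c]; simpl; try reflexivity.
  rewrite IH; f_equal; lia.
Qed.

Lemma expo_eqb_spec a b : reflect (strip a = strip b) (expo_eqb a b).
Proof.
  unfold expo_eqb; destruct (list_eq_dec Nat.eq_dec (strip a) (strip b));
    constructor; assumption.
Qed.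

(** Linear extension of a function on monomials. [padd], [pscale] and [pmul] translate into
    operations on [phi], so identities of polynomials reduce to identities between complex sums. *)
Definition lin (phi : expo -> C) (p : cpoly) : C :=
  Sum (t in p) Cmul (fst t) (phi (snd t)).

Definition strip_invariant {T : Type} (phi : expo -> T) : Prop :=
  forall a b, strip a = strip b -> phi a = phi b.

Lemma coef_cons t p m :
  coef (t :: p) m = Cadd (if expo_eqb (snd t) m then fst t else C0) (coef p m).
Proof. unfold coef; simpl; destruct (expo_eqb (snd t) m); simpl; [reflexivity|ring]. Qed.

Lemma coef_lin p m : coef p m = lin (fun e => if expo_eqb e m then C1 else C0) p.
Proof.
  induction p as [|t p IH]; [reflexivity|].
  rewrite coef_cons, IH; unfold lin; simpl.
  destruct (expo_eqb (snd t) m); ring.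
Qed.

Lemma lin_ext phi psi p : (forall e, phi e = psi e) -> lin phi p = lin psi p.
Proof. intros H; apply Csum_ext; intros t _; rewrite H; reflexivity. Qed.

Lemma lin_ext_in phi psi (p : cpoly) :
  (forall t, In t p -> phi (snd t) = psi (snd t)) -> lin phi p = lin psi p.
Proof. intros H; apply Csum_ext; intros t Ht; rewrite (H t Ht); reflexivity. Qed.

Lemma lin_add phi psi p :
  lin (fun e => Cadd (phi e) (psi e)) p = Cadd (lin phi p) (lin psi p).
Proof. unfold lin; rewrite <- Csum_add; apply Csum_ext; intros; ring. Qed.

Lemma lin_exchange (phi : expo -> expo -> C) p q :
  lin (fun e => lin (phi e) q) p = lin (fun e' => lin (fun e => phi e e') p) q.
Proof.
  unfold lin.
  transitivity (Sum (t in p) Sum (t' in q)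
    Cmul (fst t) (Cmul (fst t') (phi (snd t) (snd t')))).
  { apply Csum_ext; intros; rewrite <- Csum_mul_l; reflexivity. }
  rewrite Csum_exchange.
  apply Csum_ext; intros; rewrite <- Csum_mul_l; apply Csum_ext; intros; ring.
Qed.

Lemma lin_padd phi p q : lin phi (padd p q) = Cadd (lin phi p) (lin phi q).
Proof. apply Csum_app. Qed.

Lemma lin_pscale phi c p : lin phi (pscale c p) = Cmul c (lin phi p).
Proof.
  unfold lin, pscale; rewrite map_map, <- Csum_mul_l.
  apply Csum_ext; intros t _; simpl; ring.
Qed.

Lemma lin_pmul phi p q :
  lin phi (pmul p q) = lin (fun e => lin (fun e' => phi (eadd e e')) q) p.
Proof.
  unfold lin, pmul; rewrite Csum_flat_map.
  apply Csum_ext; intros t _; rewrite map_map, <- Csum_mul_l.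
  apply Csum_ext; intros t' _; simpl; ring.
Qed.

(** Induction on the length: all terms whose monomial is that of the head are collected at once;
    together they contribute a coefficient of [p], which is zero, and the shorter list that remains
    still has zero coefficients. *)
Lemma lin_zero p : (forall m, coef p m = C0) ->
  forall phi, strip_invariant phi -> lin phi p = C0.
Proof.
  intros H phi Hphi; remember (length p) as n eqn:Hn.
  revert p Hn H; induction n as [n IH] using lt_wf_ind; intros [|[c e] p] -> H.
  - reflexivity.
  - set (r := filter (fun t => negb (expo_eqb (snd t) e)) p).
    assert (Hlin : forall q, lin phi q =
      Cadd (Cmul (coef q e) (phi e)) (lin phi (filter (fun t => negb (expo_eqb (snd t) e)) q))).
    { induction q as [|t q IHq]; [unfold coef, lin; simpl; ring|].
      rewrite coef_cons; unfold lin in *; simpl.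
      destruct (expo_eqb_spec (snd t) e) as [He|He]; simpl; rewrite IHq.
      - rewrite (Hphi _ _ He); ring.
      - ring. }
    rewrite Hlin, H; simpl.
    destruct (expo_eqb_spec e e) as [_|He]; [simpl|contradiction].
    fold r; rewrite (IH (length r)); [ring| |reflexivity|].
    + unfold r; simpl; apply Nat.lt_succ_r, filter_length_le.
    + intros m; specialize (H m); rewrite coef_cons in H; simpl in H.
      assert (Hr : coef r m = if expo_eqb e m then C0 else coef p m).
      { unfold r; clear; induction p as [|t p IH]; simpl.
        - destruct (expo_eqb e m); reflexivity.
        - destruct (expo_eqb_spec (snd t) e) as [He|He]; simpl; rewrite ?coef_cons, IH;
            destruct (expo_eqb_spec e m) as [Hm|Hm];
            destruct (expo_eqb_spec (snd t) m) as [Ht|Ht]; try ring; congruence. }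
      rewrite Hr; destruct (expo_eqb e m); [reflexivity|].
      rewrite <- H; ring.
Qed.

(** The coefficients are themselves functionals of this form, which gives one direction; the other
    is [lin_zero] applied to the difference of [p] and [q]. *)
Lemma peq_lin p q :
  peq p q <-> forall phi, strip_invariant phi -> lin phi p = lin phi q.
Proof.
  split.
  - intros H phi Hphi.
    assert (Hz : lin phi (padd p (pscale (Copp C1) q)) = C0).
    { apply lin_zero; [|exact Hphi]; intros m.
      rewrite coef_lin, lin_padd, lin_pscale, <- !coef_lin, H; ring. }
    rewrite lin_padd, lin_pscale in Hz.
    transitivity (Cadd (lin phi q) C0); [rewrite <- Hz; ring|ring].
  - intros H m; rewrite !coef_lin; apply H; intros a b Hab.
    destruct (expo_eqb_spec a m), (expo_eqb_spec b m); congruence.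
Qed.

Lemma strip_eadd a b c d :
  strip a = strip b -> strip c = strip d -> strip (eadd a c) = strip (eadd b d).
Proof.
  rewrite !strip_eq_iff; intros H H' j; rewrite !nth_eadd, H, H'; reflexivity.
Qed.

Lemma strip_invariant_eadd_l (phi : expo -> C) a :
  strip_invariant phi -> strip_invariant (fun e => phi (eadd a e)).
Proof. intros H x y Hxy; apply H, strip_eadd; [reflexivity|exact Hxy]. Qed.

Lemma strip_invariant_lin_eadd (phi : expo -> C) q :
  strip_invariant phi -> strip_invariant (fun e => lin (fun e' => phi (eadd e e')) q).
Proof.
  intros H x y Hxy; apply lin_ext; intros e; apply H, strip_eadd; [exact Hxy|reflexivity].
Qed.

Global Instance peq_equivalence : Equivalence peq.
Proof.
  split; red; unfold peq; intros; try reflexivity.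
  - symmetry; auto.
  - etransitivity; eauto.
Qed.

Global Instance padd_proper : Proper (peq ==> peq ==> peq) padd.
Proof.
  intros p p' Hp q q' Hq; rewrite peq_lin in *; intros phi H.
  rewrite !lin_padd, (Hp _ H), (Hq _ H); reflexivity.
Qed.

Global Instance pscale_proper c : Proper (peq ==> peq) (pscale c).
Proof.
  intros p p' Hp; rewrite peq_lin in *; intros phi H.
  rewrite !lin_pscale, (Hp _ H); reflexivity.
Qed.

Global Instance pmul_proper : Proper (peq ==> peq ==> peq) pmul.
Proof.
  intros p p' Hp q q' Hq; rewrite peq_lin in *; intros phi H.
  rewrite !lin_pmul, (Hp _ (strip_invariant_lin_eadd _ _ H)).
  apply lin_ext; intros e; apply Hq, strip_invariant_eadd_l, H.
Qed.

Definition pconst (c : C) : cpoly := [(c, [])].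
Definition popp (p : cpoly) : cpoly := pscale (Copp C1) p.

Global Instance popp_proper : Proper (peq ==> peq) popp.
Proof. intros p q H; unfold popp; rewrite H; reflexivity. Qed.

Lemma lin_pconst phi c : lin phi (pconst c) = Cmul c (phi []).
Proof. unfold lin; simpl; ring. Qed.

Lemma cpoly_ring_theory :
  ring_theory (R := cpoly) [] (pconst C1) padd pmul (fun p q => padd p (popp q)) popp peq.
Proof.
  constructor; intros; try reflexivity; apply peq_lin; intros phi H;
    rewrite ?lin_padd, ?lin_pmul, ?lin_padd.
  - ring.
  - ring.
  - rewrite lin_pconst; unfold lin; simpl; ring.
  - rewrite lin_exchange; apply lin_ext; intros e; apply lin_ext; intros e'.
    rewrite eadd_comm; reflexivity.
  - apply lin_ext; intros e; rewrite lin_pmul; apply lin_ext; intros e'.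
    apply lin_ext; intros e''; rewrite eadd_assoc; reflexivity.
  - reflexivity.
  - unfold popp; rewrite lin_pscale; unfold lin; simpl; ring.
Qed.

Lemma cpoly_ring_ext : ring_eq_ext padd pmul popp peq.
Proof. constructor; try exact _. Qed.

Add Ring cpoly_ring : cpoly_ring_theory (setoid peq_equivalence cpoly_ring_ext).

Lemma pscale_pmul c p : peq (pscale c p) (pmul (pconst c) p).
Proof.
  apply peq_lin; intros phi H.
  rewrite lin_pscale, lin_pmul, lin_pconst; reflexivity.
Qed.

(** * The operators *)

Local Arguments pmul : simpl never.
Local Arguments padd : simpl never.
Local Arguments pscale : simpl never.
Local Arguments peq : simpl never.

Definition mono_ext (M : expo -> cpoly) (p : cpoly) : cpoly :=
  flat_map (fun t => pscale (fst t) (M (snd t))) p.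

Lemma lin_mono_ext phi M p :
  lin phi (mono_ext M p) = lin (fun e => lin phi (M e)) p.
Proof.
  unfold mono_ext, lin at 1; rewrite Csum_flat_map.
  apply Csum_ext; intros t _; apply lin_pscale.
Qed.

Lemma plinear_mono_ext M : strip_invariant M -> plinear (mono_ext M).
Proof.
  intros HM; split; [|split]; intros; rewrite peq_lin in *; intros phi Hphi;
    rewrite ?lin_padd, ?lin_pscale, ?lin_mono_ext, ?lin_padd, ?lin_pscale; try reflexivity.
  apply H; intros a b Hab; rewrite (HM _ _ Hab); reflexivity.
Qed.

Fixpoint gens_from (j : nat) (l : list nat) : list nat :=
  match l with
  | [] => []
  | x :: l => repeat j x ++ gens_from (S j) l
  end.

(* The indices of the [v_j] in the monomial, listed with multiplicity: operators
   defined by recursion on this list respect [strip] on the nose. *)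
Definition gens (e : expo) : list nat := gens_from 1 (tl e).

Lemma gens_from_strip j l : gens_from j (strip l) = gens_from j l.
Proof.
  revert j; induction l as [|x l IH]; intros j; simpl; [reflexivity|].
  rewrite <- IH; destruct (strip l) as [|y s]; [|reflexivity].
  destruct (Nat.eqb_spec x 0) as [->|]; reflexivity.
Qed.

Lemma gens_strip e : gens (strip e) = gens e.
Proof.
  destruct e as [|x l]; [reflexivity|]; unfold gens; simpl.
  rewrite <- (gens_from_strip 1 l); destruct (strip l); [|reflexivity].
  destruct (Nat.eqb x 0); reflexivity.
Qed.

Lemma strip_invariant_gens (F : nat -> list nat -> cpoly) :
  strip_invariant (fun e => F (nth 0 e 0%nat) (gens e)).
Proof.
  intros a b H; rewrite <- (nth_strip a), <- (gens_strip a), H, nth_strip, gens_strip.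
  reflexivity.
Qed.

Lemma count_gens_from s l i :
  count_occ Nat.eq_dec (gens_from s l) i = if (i <? s)%nat then 0%nat else nth (i - s) l 0%nat.
Proof.
  revert s; induction l as [|x l IH]; intros s; simpl.
  - destruct (i <? s)%nat, (i - s)%nat; reflexivity.
  - rewrite count_occ_app, IH.
    destruct (Nat.eq_dec s i) as [->|Hi].
    + rewrite count_occ_repeat_eq by reflexivity.
      rewrite Nat.ltb_irrefl, Nat.sub_diag.
      replace (i <? S i)%nat with true by (symmetry; apply Nat.ltb_lt; lia); lia.
    + rewrite count_occ_repeat_neq by congruence.
      destruct (Nat.ltb_spec i s), (Nat.ltb_spec i (S s)); try lia.
      replace (i - s)%nat with (S (i - S s)) by lia; reflexivity.
Qed.

Lemma count_gens e i :
  count_occ Nat.eq_dec (gens e) i = if Nat.eqb i 0 then 0%nat else nth i e 0%nat.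
Proof.
  unfold gens; rewrite count_gens_from.
  destruct i as [|i]; [reflexivity|]; simpl; rewrite Nat.sub_0_r.
  destruct e; [destruct i|]; reflexivity.
Qed.

(** The polynomial [pv 0] is u and not a trace variable, so positivity of the indices is what makes
    products of [pv] scalar and lets them evaluate to traces. *)
Lemma gens_pos e : Forall (fun j => (1 <= j)%nat) (gens e).
Proof.
  apply Forall_forall; intros j Hj.
  apply (count_occ_In Nat.eq_dec) in Hj; rewrite count_gens in Hj.
  destruct j; simpl in Hj; lia.
Qed.

(** Equality holds only up to order, since [gens] lists indices increasingly and a concatenation
    need not; operators on these lists must then be compared modulo permutation. *)
Lemma gens_eadd a b : Permutation (gens (eadd a b)) (gens a ++ gens b).
Proof.
  apply (Permutation_count_occ Nat.eq_dec); intros i.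
  rewrite count_occ_app, !count_gens, nth_eadd; destruct (Nat.eqb i 0); reflexivity.
Qed.

Fixpoint mono (k : nat) (l : list nat) : cpoly :=
  match l with
  | [] => pu k
  | j :: l => pmul (pv j) (mono k l)
  end.

Lemma nth_pv j i : nth i (repeat 0%nat j ++ [1%nat]) 0%nat = if Nat.eqb i j then 1%nat else 0%nat.
Proof.
  revert i; induction j as [|j IH]; intros [|i]; simpl; try reflexivity.
  - destruct i; reflexivity.
  - apply IH.
Qed.

Lemma peq_single a b : strip a = strip b -> peq [(C1, a)] [(C1, b)].
Proof.
  intros H; apply peq_lin; intros phi Hphi; unfold lin; simpl.
  rewrite (Hphi _ _ H); reflexivity.
Qed.

Lemma pmul_single a b : peq (pmul [(C1, a)] [(C1, b)]) [(C1, eadd a b)].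
Proof. apply peq_lin; intros phi Hphi; unfold lin, pmul; simpl; ring. Qed.

Lemma mono_single k l : exists e, peq (mono k l) [(C1, e)] /\
  forall i, nth i e 0%nat = ((if Nat.eqb i 0 then k else 0) + count_occ Nat.eq_dec l i)%nat.
Proof.
  induction l as [|j l [e [He Hn]]].
  - exists [k]; split; [reflexivity|]; intros [|[|i]]; simpl; lia.
  - exists (eadd (repeat 0%nat j ++ [1%nat]) e); split.
    + simpl; rewrite He; apply pmul_single.
    + intros i; rewrite nth_eadd, nth_pv, Hn; simpl.
      destruct (Nat.eq_dec j i) as [->|H].
      * rewrite Nat.eqb_refl; lia.
      * replace (Nat.eqb i j) with false by (symmetry; apply Nat.eqb_neq; lia); lia.
Qed.

(** Both sides carry the same exponents up to trailing zeros; this passes from the encoded monomial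
    to the product over which the operators recurse. *)
Lemma single_mono e : peq [(C1, e)] (mono (nth 0 e 0%nat) (gens e)).
Proof.
  destruct (mono_single (nth 0 e 0%nat) (gens e)) as [e' [He Hn]].
  rewrite He; apply peq_single, strip_eq_iff; intros i.
  rewrite Hn, count_gens; destruct i; simpl; lia.
Qed.

(** The right-hand side of condition (1); for k = 0 it is zero, which is also the correct value on
    constants. *)
Definition Du (k : nat) : cpoly :=
  padd (pscale (RtoC (- INR k)) (pu k))
    (pscale (RtoC (-2))
       (psum (map (fun m => pscale (RtoC (INR m)) (pmul (pu m) (pv (k - m))))
                  (seq 1 (k - 1))))).

Definition Dv (k : nat) : cpoly :=
  padd (pscale (RtoC (- INR k)) (pv k))
    (pscale (RtoC (-2))
       (psum (map (fun m => pscale (RtoC (INR m)) (pmul (pv m) (pv (k - m))))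
                  (seq 1 (k - 1))))).

(** The product rule is applied to the factors v_j only; the block u^k receives its prescribed value
    as a whole. *)
Fixpoint Dmono (k : nat) (l : list nat) : cpoly :=
  match l with
  | [] => Du k
  | j :: l => padd (pmul (Dv j) (mono k l)) (pmul (pv j) (Dmono k l))
  end.

(* [cross j] is the derivation with [cross j (u^k) = j k u^(j+k)] and
   [cross j (v_i) = j i v_(i+j)], i.e. [- N^2] times the carre du champ
   [sum_X (X~ tr U^j) (X~ _)]. *)
Fixpoint cross (j k : nat) (l : list nat) : cpoly :=
  match l with
  | [] => pscale (RtoC (INR j * INR k)) (pu (j + k))
  | i :: l => padd (pscale (RtoC (INR j * INR i)) (pmul (pv (j + i)) (mono k l)))
                   (pmul (pv i) (cross j k l))
  end.

(** Each factor v_j is paired only with the factors after it, including u^k, so every unordered pair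
    occurs once; the 2 counts the two orders in which the derivatives can hit it. *)
Fixpoint Lmono (k : nat) (l : list nat) : cpoly :=
  match l with
  | [] => []
  | j :: l => padd (pscale (RtoC 2) (cross j k l)) (pmul (pv j) (Lmono k l))
  end.

Definition opD : cpoly -> cpoly := mono_ext (fun e => Dmono (nth 0 e 0%nat) (gens e)).
Definition opL : cpoly -> cpoly := mono_ext (fun e => Lmono (nth 0 e 0%nat) (gens e)).

Lemma plinear_opD : plinear opD.
Proof. apply plinear_mono_ext, strip_invariant_gens. Qed.

Global Instance opD_proper : Proper (peq ==> peq) opD := proj1 plinear_opD.

Lemma plinear_opL : plinear opL.
Proof. apply plinear_mono_ext, strip_invariant_gens. Qed.

(** * The product rule for D with one scalar factor *)

Fixpoint vprod (l : list nat) : cpoly :=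
  match l with
  | [] => pconst C1
  | j :: l => pmul (pv j) (vprod l)
  end.

Fixpoint Dvprod (l : list nat) : cpoly :=
  match l with
  | [] => []
  | j :: l => padd (pmul (Dv j) (vprod l)) (pmul (pv j) (Dvprod l))
  end.

Lemma mono_vprod k l : peq (mono k l) (pmul (pu k) (vprod l)).
Proof. induction l as [|j l IH]; simpl; [|rewrite IH]; ring. Qed.

Lemma Dmono_Dvprod k l :
  peq (Dmono k l) (padd (pmul (Du k) (vprod l)) (pmul (pu k) (Dvprod l))).
Proof. induction l as [|j l IH]; simpl; [|rewrite IH, mono_vprod]; ring. Qed.

Lemma vprod_app l l' : peq (vprod (l ++ l')) (pmul (vprod l) (vprod l')).
Proof. induction l as [|j l IH]; simpl; [|rewrite IH]; ring. Qed.

Lemma Dvprod_app l l' :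
  peq (Dvprod (l ++ l')) (padd (pmul (Dvprod l) (vprod l')) (pmul (vprod l) (Dvprod l'))).
Proof. induction l as [|j l IH]; simpl; [|rewrite IH, vprod_app]; ring. Qed.

Lemma vprod_perm l l' : Permutation l l' -> peq (vprod l) (vprod l').
Proof.
  induction 1 as [|j l l' _ IH|i j l|l l' l'' _ IH _ IH']; simpl.
  - reflexivity.
  - rewrite IH; reflexivity.
  - ring.
  - rewrite IH; exact IH'.
Qed.

Lemma Dvprod_perm l l' : Permutation l l' -> peq (Dvprod l) (Dvprod l').
Proof.
  induction 1 as [|j l l' H IH|i j l|l l' l'' _ IH _ IH']; simpl.
  - reflexivity.
  - rewrite IH, (vprod_perm _ _ H); reflexivity.
  - ring.
  - rewrite IH; exact IH'.
Qed.

Lemma pu_0 : peq (pu 0) (pconst C1).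
Proof. apply peq_single; reflexivity. Qed.

Lemma Du_0 : peq (Du 0) [].
Proof.
  apply peq_lin; intros phi Hphi; unfold Du; rewrite lin_padd, !lin_pscale.
  replace (RtoC (- INR 0)) with C0 by (apply C_ext; simpl; ring).
  unfold lin; simpl; ring.
Qed.

(** Since [a] contains no u, the block u^k of [b] is not enlarged; only the lists of v_j are merged,
    and on these D acts as a derivation independent of their order. *)
Lemma Dmono_eadd a b : nth 0 a 0%nat = 0%nat ->
  peq (Dmono (nth 0 (eadd a b) 0%nat) (gens (eadd a b)))
      (padd (pmul (Dmono (nth 0 a 0%nat) (gens a)) [(C1, b)])
            (pmul [(C1, a)] (Dmono (nth 0 b 0%nat) (gens b)))).
Proof.
  intros Ha.
  rewrite (single_mono a), (single_mono b), !Dmono_Dvprod, !mono_vprod.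
  rewrite (vprod_perm _ _ (gens_eadd a b)), (Dvprod_perm _ _ (gens_eadd a b)).
  rewrite vprod_app, Dvprod_app, nth_eadd, Ha, Nat.add_0_l, Du_0, pu_0; ring.
Qed.

(** Scalarity is a condition on coefficients, so the list of a scalar polynomial may still contain
    terms in u that cancel. Dropping them gives a representative that is scalar term by term. *)
Definition no_u (p : cpoly) : cpoly := filter (fun t : term => Nat.eqb (nth 0 (snd t) 0%nat) 0) p.

Lemma scalar_no_u p : scalar p -> peq p (no_u p).
Proof.
  intros Hp m.
  assert (H : coef (no_u p) m = if Nat.eqb (nth 0 m 0%nat) 0 then coef p m else C0).
  { unfold no_u; clear; induction p as [|t p IH]; cbn [filter].
    - destruct (Nat.eqb (nth 0 m 0%nat) 0); reflexivity.
    - destruct (Nat.eqb_spec (nth 0 (snd t) 0%nat) 0) as [Ht|Ht]; rewrite ?coef_cons, IH;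
        destruct (expo_eqb_spec (snd t) m) as [Hm|Hm];
        try rewrite strip_eq_iff in Hm;
        destruct (Nat.eqb_spec (nth 0 m 0%nat) 0) as [H|H]; try ring;
        rewrite Hm in Ht; contradiction. }
  rewrite H; destruct (Nat.eqb_spec (nth 0 m 0%nat) 0); [reflexivity|].
  apply Hp; assumption.
Qed.

Lemma lin_term phi c e : lin phi [(c, e)] = Cmul c (phi e).
Proof. unfold lin; simpl; ring. Qed.

Lemma opD_pmul_scalar_l p q : scalar p ->
  peq (opD (pmul p q)) (padd (pmul (opD p) q) (pmul p (opD q))).
Proof.
  intros Hp; rewrite (scalar_no_u p Hp).
  apply peq_lin; intros phi Hphi.
  unfold opD; rewrite lin_padd, lin_mono_ext, !lin_pmul, lin_mono_ext.
  rewrite <- lin_add; apply lin_ext_in; intros t Ht.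
  apply filter_In in Ht as [_ Ht]; apply Nat.eqb_eq in Ht.
  rewrite lin_mono_ext, lin_exchange, <- lin_add.
  apply lin_ext; intros e.
  rewrite (proj1 (peq_lin _ _) (Dmono_eadd (snd t) e Ht) phi Hphi).
  rewrite lin_padd, !lin_pmul, lin_term; f_equal; [|ring].
  apply lin_ext; intros e'; rewrite lin_term; ring.
Qed.

Lemma opD_single e : peq (opD [(C1, e)]) (Dmono (nth 0 e 0%nat) (gens e)).
Proof.
  apply peq_lin; intros phi Hphi; unfold opD; rewrite lin_mono_ext, lin_term; ring.
Qed.

Lemma gens_pv k : (1 <= k)%nat -> gens (repeat 0%nat k ++ [1%nat]) = [k].
Proof.
  intros Hk; destruct k as [|k]; [lia|]; unfold gens; simpl; clear Hk.
  (* The induction needs the starting index of [gens_from] to vary; the exponent 1 inside the list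
     stays fixed. *)
  change (S k) with (1 + k)%nat; generalize 1%nat at 1 3 as s.
  induction k as [|k IH]; intros s; simpl; [rewrite Nat.add_0_r; reflexivity|].
  rewrite IH; f_equal; lia.
Qed.

Lemma opD_props : D_props opD.
Proof.
  split; [|split].
  - intros k Hk; apply (opD_single [k]).
  - intros k Hk; unfold pv at 1; rewrite opD_single, gens_pv, nth_pv by assumption.
    replace (Nat.eqb 0 k) with false by (symmetry; apply Nat.eqb_neq; lia).
    simpl Dmono; rewrite Du_0, pu_0; fold (Dv k); ring.
  - intros p q [H|H]; [apply opD_pmul_scalar_l; exact H|].
    assert (Hc : peq (pmul p q) (pmul q p)) by ring.
    rewrite Hc, opD_pmul_scalar_l by exact H; ring.
Qed.

Lemma scalar_pv k : (1 <= k)%nat -> scalar (pv k).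
Proof.
  intros Hk m Hm; unfold pv; rewrite coef_cons; simpl.
  destruct (expo_eqb_spec (repeat 0%nat k ++ [1%nat]) m) as [H|H];
    [|unfold coef; simpl; ring].
  rewrite strip_eq_iff in H; rewrite <- H, nth_pv in Hm.
  destruct k; simpl in Hm; lia.
Qed.

Lemma scalar_vprod l : Forall (fun j => (1 <= j)%nat) l -> scalar (vprod l).
Proof.
  intros Hl m Hm.
  assert (H : peq (vprod l) (mono 0 l)) by (rewrite mono_vprod, pu_0; ring).
  rewrite H.
  destruct (mono_single 0 l) as [e [He Hn]].
  rewrite He, coef_cons; simpl.
  destruct (expo_eqb_spec e m) as [Hs|_]; [|unfold coef; simpl; ring].
  rewrite strip_eq_iff in Hs; rewrite <- Hs, Hn in Hm.
  exfalso; apply Hm.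
  simpl; apply count_occ_not_In; intros H0.
  rewrite Forall_forall in Hl; specialize (Hl _ H0); lia.
Qed.

(** Applied to the values of a linear operator at 0 = 0 + 0, and at 1 = 1 · 1 by the product
    rule. *)
Lemma peq_cancel p : peq p (padd p p) -> peq p [].
Proof.
  intros H m; specialize (H m); rewrite !coef_lin, lin_padd in *.
  change (lin _ []) with C0.
  match goal with |- ?x = _ => transitivity (Cadd (Cadd x x) (Copp x)); [ring|] end.
  rewrite <- H; ring.
Qed.

(** * Uniqueness of D *)

Section Uniqueness.
Variable D' : cpoly -> cpoly.
Hypothesis linD' : plinear D'.
Hypothesis propsD' : D_props D'.

Let D'_ext : Proper (peq ==> peq) D' := proj1 linD'.
Local Existing Instance D'_ext.

Lemma D'_one : peq (D' (pconst C1)) [].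
Proof.
  apply peq_cancel.
  assert (H : peq (pconst C1) (pmul (pconst C1) (pconst C1))) by ring.
  rewrite H at 1; rewrite (proj2 (proj2 propsD')); [ring|].
  left; exact (scalar_vprod [] (Forall_nil _)).
Qed.

Lemma D'_pu k : peq (D' (pu k)) (Du k).
Proof.
  destruct k as [|k]; [rewrite Du_0, pu_0; apply D'_one|].
  apply (proj1 propsD'); lia.
Qed.

Lemma D'_vprod l : Forall (fun j => (1 <= j)%nat) l -> peq (D' (vprod l)) (Dvprod l).
Proof.
  induction 1 as [|j l Hj _ IH]; simpl; [apply D'_one|].
  rewrite (proj2 (proj2 propsD')) by (left; apply scalar_pv; exact Hj).
  rewrite IH, (proj1 (proj2 propsD')) by exact Hj; reflexivity.
Qed.

(** The product rule splits u^k from the scalar product of the v_j; condition (1) settles the block,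
    and condition (2) with repeated use of (3) settles the product. *)
Lemma D'_single e : peq (D' [(C1, e)]) (Dmono (nth 0 e 0%nat) (gens e)).
Proof.
  rewrite single_mono, mono_vprod, Dmono_Dvprod.
  rewrite (proj2 (proj2 propsD')) by (right; apply scalar_vprod, gens_pos).
  rewrite D'_pu, D'_vprod by apply gens_pos; reflexivity.
Qed.

Lemma D_props_unique p : peq (D' p) (opD p).
Proof.
  pose proof (proj2 linD') as [Hadd Hscale].
  induction p as [|[c e] p IH].
  - change [] with (padd [] []) at 1; apply peq_cancel.
    rewrite <- Hadd; reflexivity.
  - assert (H : peq ((c, e) :: p) (padd (pscale c [(C1, e)]) p)).
    { apply peq_lin; intros phi Hphi; rewrite lin_padd, lin_pscale.
      unfold lin; simpl; ring. }
    rewrite H, Hadd, Hscale, D'_single, IH.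
    apply peq_lin; intros phi Hphi.
    unfold opD; rewrite lin_mono_ext, !lin_padd, !lin_pscale, lin_mono_ext, lin_term; ring.
Qed.

End Uniqueness.

(** * The exponential curve and derivatives along it *)

(** An l^1 norm: it is submultiplicative and bounds the real and the imaginary part without square
    roots. *)
Definition Cabs1 (z : C) : R := Rabs (fst z) + Rabs (snd z).

Lemma Cabs1_add a b : Cabs1 (Cadd a b) <= Cabs1 a + Cabs1 b.
Proof.
  unfold Cabs1; simpl.
  pose proof (Rabs_triang (fst a) (fst b)); pose proof (Rabs_triang (snd a) (snd b)); lra.
Qed.

Lemma Cabs1_mul a b : Cabs1 (Cmul a b) <= Cabs1 a * Cabs1 b.
Proof.
  unfold Cabs1; simpl.
  pose proof (Rabs_triang (fst a * fst b) (- (snd a * snd b))) as H1.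
  pose proof (Rabs_triang (fst a * snd b) (snd a * fst b)) as H2.
  rewrite Rabs_Ropp in H1; rewrite !Rabs_mult in H1, H2; unfold Rminus; lra.
Qed.

Lemma Cabs1_pos a : 0 <= Cabs1 a.
Proof. unfold Cabs1; pose proof (Rabs_pos (fst a)); pose proof (Rabs_pos (snd a)); lra. Qed.

Lemma finite_bound (f : nat -> R) n :
  exists M, 0 <= M /\ forall i, (i < n)%nat -> f i <= M.
Proof.
  induction n as [|n [M [HM H]]]; [exists 0; split; [lra|intros; lia]|].
  exists (Rmax M (f n)); split; [apply Rle_trans with M; [exact HM|apply Rmax_l]|].
  intros i Hi; destruct (Nat.eq_dec i n) as [->|]; [apply Rmax_r|].
  apply Rle_trans with M; [apply H; lia|apply Rmax_l].
Qed.

Lemma matrix_bound (X : Mat) N :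
  exists M, 0 <= M /\ forall i j, (i < N)%nat -> (j < N)%nat -> Cabs1 (X i j) <= M.
Proof.
  assert (Hrow : forall i, exists M, 0 <= M /\ forall j, (j < N)%nat -> Cabs1 (X i j) <= M)
    by (intros i; apply finite_bound).
  set (r := fun i => epsilon (inhabits 0)
    (fun M => 0 <= M /\ forall j, (j < N)%nat -> Cabs1 (X i j) <= M)).
  destruct (finite_bound r N) as [M [HM H]]; exists M; split; [exact HM|].
  intros i j Hi Hj; apply Rle_trans with (r i); [|apply H; exact Hi].
  exact (proj2 (epsilon_spec (inhabits 0) _ (Hrow i)) j Hj).
Qed.

Lemma Csum_bound {T} (f : T -> C) l M :
  (forall x, In x l -> Cabs1 (f x) <= M) -> Cabs1 (Sum (x in l) f x) <= INR (length l) * M.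
Proof.
  induction l as [|x l IH]; intros H; [unfold Cabs1; simpl; rewrite Rabs_R0; lra|].
  change (Cabs1 (Cadd (f x) (Sum (x in l) f x)) <= INR (1 + length l) * M).
  rewrite plus_INR; change (INR 1) with 1.
  pose proof (Cabs1_add (f x) (Sum (x in l) f x)).
  specialize (IH (fun y Hy => H y (or_intror Hy))).
  specialize (H x (or_introl eq_refl)); lra.
Qed.

Lemma mpow_bound (X : Mat) N :
  exists K, 0 <= K /\ forall n i j, (i < N)%nat -> (j < N)%nat ->
    Cabs1 (mpow N X n i j) <= K ^ n.
Proof.
  destruct (matrix_bound X N) as [M [HM H]].
  (* An entry of a product is a sum of N terms, each at most M times a bound for the previous
     power. *)
  exists (INR N * M).
  assert (HK : 0 <= INR N * M) by (apply Rmult_le_pos; [apply pos_INR|exact HM]).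
  split; [exact HK|].
  induction n as [|n IH]; intros i j Hi Hj; simpl.
  - unfold mid, Cabs1; destruct (Nat.eqb i j); simpl; rewrite ?Rabs_R0, ?Rabs_R1; lra.
  - unfold mmul; rewrite Rmult_assoc.
    replace (INR N) with (INR (length (seq 0 N))) at 1 by (rewrite length_seq; reflexivity).
    apply Csum_bound; intros k Hk; apply in_seq in Hk.
    eapply Rle_trans; [apply Cabs1_mul|].
    apply Rmult_le_compat; try apply Cabs1_pos; [apply H|apply IH]; lia.
Qed.

(** For every r the sequence (K r)^n / n! converges, hence is bounded, so the radius is at least
    every r. *)
Lemma CV_radius_factorial (a : nat -> R) K :
  (forall n, Rabs (a n) <= K ^ n / INR (fact n)) -> CV_radius a = p_infty.
Proof.
  intros H.
  assert (Hr : forall r, 0 <= r -> Rbar_le (Finite r) (CV_radius a)).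
  { intros r Hr.
    apply (proj1 (CV_radius_bounded a)).
    destruct (maj_by_pos (fun n => (K * r) ^ n / INR (fact n))) as [M [_ HM]].
    { exists 0; apply cv_speed_pow_fact. }
    exists M; intros n; specialize (HM n); specialize (H n).
    rewrite Rabs_mult, <- RPow_abs, (Rabs_pos_eq r Hr).
    eapply Rle_trans; [apply Rmult_le_compat_r; [apply pow_le; exact Hr|exact H]|].
    eapply Rle_trans; [|exact HM].
    eapply Rle_trans; [|apply Rle_abs].
    rewrite Rpow_mult_distr; unfold Rdiv; right; ring. }
  destruct (CV_radius a) as [x| |]; [exfalso|reflexivity|exfalso].
  - specialize (Hr (Rabs x + 1)); simpl in Hr.
    pose proof (Rabs_pos x); pose proof (Rle_abs x); lra.
  - specialize (Hr 0 (Rle_refl 0)); exact Hr.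
Qed.

Definition expcoef (proj : C -> R) (N : nat) (X : Mat) (i j n : nat) : R :=
  / INR (fact n) * proj (mpow N X n i j).

(** Power series and limits are available over the reals; statements about an entry are proved once
    for its real and imaginary parts alike. *)
Definition is_projection (proj : C -> R) : Prop := proj = fst \/ proj = snd.

Lemma CV_radius_expcoef proj N X i j : is_projection proj ->
  (i < N)%nat -> (j < N)%nat -> CV_radius (expcoef proj N X i j) = p_infty.
Proof.
  intros Hp Hi Hj; destruct (mpow_bound X N) as [K [HK H]].
  apply CV_radius_factorial with K; intros n; unfold expcoef.
  pose proof (INR_fact_lt_0 n) as Hf; apply Rinv_0_lt_compat in Hf.
  rewrite Rabs_mult, (Rabs_pos_eq (/ _)) by lra.
  unfold Rdiv; rewrite Rmult_comm; apply Rmult_le_compat_r; [lra|].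
  eapply Rle_trans; [|apply (H n i j); assumption].
  unfold Cabs1; pose proof (Rabs_pos (fst (mpow N X n i j)));
    pose proof (Rabs_pos (snd (mpow N X n i j))); destruct Hp as [->| ->]; lra.
Qed.

Lemma mpow_mscale N s X n i j :
  mpow N (mscale (RtoC s) X) n i j = Cmul (RtoC (s ^ n)) (mpow N X n i j).
Proof.
  revert i j; induction n as [|n IH]; intros i j; simpl.
  - apply C_ext; simpl; ring.
  - unfold mmul; rewrite <- Csum_mul_l; apply Csum_ext; intros k _.
    rewrite IH; unfold mscale; apply C_ext; simpl; ring.
Qed.

Lemma exp_partial_sum proj N X s n i j : is_projection proj ->
  sum_n (fun m => expcoef proj N X i j m * s ^ m) n =
  proj (exp_partial N (mscale (RtoC s) X) n i j).
Proof.
  intros Hp; induction n as [|n IH].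
  - rewrite sum_O; unfold expcoef; simpl; field_simplify; reflexivity.
  - rewrite sum_Sn, IH; unfold expcoef.
    change (exp_partial N (mscale (RtoC s) X) (S n) i j) with
      (Cadd (exp_partial N (mscale (RtoC s) X) n i j)
            (Cmul (RtoC (/ INR (fact (S n)))) (mpow N (mscale (RtoC s) X) (S n) i j))).
    rewrite mpow_mscale; set (z := mpow N X (S n) i j); set (y := / INR (fact (S n))).
    set (w := s ^ S n).
    destruct Hp as [->| ->]; unfold plus; simpl; ring.
Qed.

Lemma exp_partial_cv proj N X s i j : is_projection proj ->
  (i < N)%nat -> (j < N)%nat ->
  Un_cv (fun n => proj (exp_partial N (mscale (RtoC s) X) n i j))
        (PSeries (expcoef proj N X i j) s).
Proof.
  intros Hp Hi Hj; apply is_lim_seq_Reals.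
  apply is_lim_seq_ext with (sum_n (fun m => expcoef proj N X i j m * s ^ m)).
  { intros n; apply exp_partial_sum, Hp. }
  apply (proj1 (is_pseries_R _ _ _)), PSeries_correct, CV_radius_inside.
  rewrite CV_radius_expcoef by assumption; exact I.
Qed.

(** The convergent entry series provide a witness for [is_expm], so the matrix chosen by [epsilon]
    satisfies it, and uniqueness of limits identifies its entries. *)
Lemma expm_PSeries proj N X s i j : is_projection proj ->
  (i < N)%nat -> (j < N)%nat ->
  proj (expm N (mscale (RtoC s) X) i j) = PSeries (expcoef proj N X i j) s.
Proof.
  intros Hp Hi Hj.
  assert (H : is_expm N (mscale (RtoC s) X) (expm N (mscale (RtoC s) X))).
  { apply (epsilon_spec (inhabits mzero) (is_expm N (mscale (RtoC s) X))).
    exists (fun i j => (PSeries (expcoef fst N X i j) s, PSeries (expcoef snd N X i j) s)).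
    intros a b Ha Hb; split; apply exp_partial_cv; try assumption; [left|right]; reflexivity. }
  destruct (H i j Hi Hj) as [H1 H2].
  eapply UL_sequence; [|apply exp_partial_cv; assumption].
  destruct Hp as [->| ->]; assumption.
Qed.

Lemma mpow_1 N X i j : (j < N)%nat -> mpow N X 1 i j = X i j.
Proof.
  intros Hj; simpl; unfold mmul.
  rewrite <- (Csum_delta N (fun k => X i k) j Hj).
  apply Csum_ext; intros k _; unfold mid; rewrite (Nat.eqb_sym j k); ring.
Qed.

Lemma expm_0 N X i j : (i < N)%nat -> (j < N)%nat ->
  expm N (mscale (RtoC 0) X) i j = mid i j.
Proof.
  intros Hi Hj.
  apply C_ext; [rewrite (expm_PSeries fst) by (try assumption; left; reflexivity)
               |rewrite (expm_PSeries snd) by (try assumption; right; reflexivity)];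
    rewrite PSeries_0; unfold expcoef; simpl; field.
Qed.

Definition is_Cderive (f : R -> C) (l : C) : Prop :=
  derivable_pt_lim (fun s => fst (f s)) 0 (fst l) /\
  derivable_pt_lim (fun s => snd (f s)) 0 (snd l).

(** Differentiating the power series at 0 leaves only the linear coefficient, which is the entry of
    X. *)
Lemma expm_derive N X i j : (i < N)%nat -> (j < N)%nat ->
  is_Cderive (fun s => expm N (mscale (RtoC s) X) i j) (X i j).
Proof.
  intros Hi Hj.
  assert (H : forall proj, is_projection proj ->
    derivable_pt_lim (fun s => proj (expm N (mscale (RtoC s) X) i j)) 0 (proj (X i j))).
  { intros proj Hp; apply is_derive_Reals.
    apply is_derive_ext with (PSeries (expcoef proj N X i j)).
    { intros s; symmetry; apply expm_PSeries; assumption. }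
    replace (proj (X i j)) with (PSeries (PS_derive (expcoef proj N X i j)) 0).
    - apply is_derive_PSeries; rewrite CV_radius_expcoef by assumption; exact I.
    - rewrite PSeries_0; unfold PS_derive, expcoef.
      rewrite mpow_1 by exact Hj; simpl; field. }
  split; apply H; [left|right]; reflexivity.
Qed.

Lemma is_Cderive_const c : is_Cderive (fun _ => c) C0.
Proof. split; apply derivable_pt_lim_const. Qed.

Lemma is_Cderive_add f g l m : is_Cderive f l -> is_Cderive g m ->
  is_Cderive (fun s => Cadd (f s) (g s)) (Cadd l m).
Proof.
  intros [F1 F2] [G1 G2]; split; simpl.
  - apply (derivable_pt_lim_plus _ _ _ _ _ F1 G1).
  - apply (derivable_pt_lim_plus _ _ _ _ _ F2 G2).
Qed.

Lemma is_Cderive_mul f g l m : is_Cderive f l -> is_Cderive g m ->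
  is_Cderive (fun s => Cmul (f s) (g s)) (Cadd (Cmul l (g 0)) (Cmul (f 0) m)).
Proof.
  intros [F1 F2] [G1 G2]; split; simpl.
  - replace (_ + _) with ((fst l * fst (g 0) + fst (f 0) * fst m) -
      (snd l * snd (g 0) + snd (f 0) * snd m)) by ring.
    apply (derivable_pt_lim_minus _ _ _ _ _
      (derivable_pt_lim_mult _ _ _ _ _ F1 G1) (derivable_pt_lim_mult _ _ _ _ _ F2 G2)).
  - replace (_ + _) with ((fst l * snd (g 0) + fst (f 0) * snd m) +
      (snd l * fst (g 0) + snd (f 0) * fst m)) by ring.
    apply (derivable_pt_lim_plus _ _ _ _ _
      (derivable_pt_lim_mult _ _ _ _ _ F1 G2) (derivable_pt_lim_mult _ _ _ _ _ F2 G1)).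
Qed.

Lemma rderiv_eq g s l : derivable_pt_lim g s l -> rderiv g s = l.
Proof.
  intros H; apply (uniqueness_limite g s); [|exact H].
  apply (epsilon_spec (inhabits 0) (fun l => derivable_pt_lim g s l)); exists l; exact H.
Qed.

(** * First and second derivatives along the curves V e^(sX) *)

Section Directional.
Variables (N : nat) (X : Mat).

Definition flow (V : Mat) (s : R) : Mat := mmul N V (expm N (mscale (RtoC s) X)).

(* The second clause is needed because [flow V 0] and [V] agree only on indices
   below [N]. *)
Definition is_dir (F G : Mat -> C) : Prop :=
  forall V, is_Cderive (fun s => F (flow V s)) (G V) /\ F (flow V 0) = F V.

Definition is_mdir (F G : Mat -> Mat) : Prop :=
  forall i j, (i < N)%nat -> (j < N)%nat -> is_dir (fun V => F V i j) (fun V => G V i j).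

(** An equality of functions rather than of values at one point, so that the inner derivative can be
    replaced by its formula before the outer one is taken. *)
Lemma Xtilde_dir F G : is_dir F G -> Xtilde N X F = G.
Proof.
  intros H; apply functional_extensionality; intros V; destruct (H V) as [[H1 H2] _].
  apply C_ext; simpl; apply rderiv_eq; assumption.
Qed.

Lemma is_dir_ext F G G' : is_dir F G -> (forall V, G V = G' V) -> is_dir F G'.
Proof. intros H HG V; rewrite <- HG; apply H. Qed.

Lemma is_dir_const c : is_dir (fun _ => c) (fun _ => C0).
Proof. intros V; split; [apply is_Cderive_const|reflexivity]. Qed.

Lemma is_dir_add F G F' G' : is_dir F F' -> is_dir G G' ->
  is_dir (fun V => Cadd (F V) (G V)) (fun V => Cadd (F' V) (G' V)).
Proof.
  intros HF HG V; destruct (HF V) as [DF EF], (HG V) as [DG EG]; split.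
  - apply is_Cderive_add; assumption.
  - rewrite EF, EG; reflexivity.
Qed.

Lemma is_dir_mul F G F' G' : is_dir F F' -> is_dir G G' ->
  is_dir (fun V => Cmul (F V) (G V))
         (fun V => Cadd (Cmul (F' V) (G V)) (Cmul (F V) (G' V))).
Proof.
  intros HF HG V; destruct (HF V) as [DF EF], (HG V) as [DG EG]; split.
  - pose proof (is_Cderive_mul _ _ _ _ DF DG) as H; cbv beta in H.
    rewrite EF, EG in H; exact H.
  - rewrite EF, EG; reflexivity.
Qed.

Lemma is_dir_scale c F G : is_dir F G ->
  is_dir (fun V => Cmul c (F V)) (fun V => Cmul c (G V)).
Proof.
  intros H; eapply is_dir_ext; [apply is_dir_mul; [apply is_dir_const|exact H]|].
  intros V; simpl; ring.
Qed.

Lemma is_dir_sum {T} (F G : T -> Mat -> C) l :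
  (forall x, In x l -> is_dir (F x) (G x)) ->
  is_dir (fun V => Sum (x in l) F x V) (fun V => Sum (x in l) G x V).
Proof.
  intros H; induction l as [|x l IH]; simpl; [apply is_dir_const|].
  apply is_dir_add; [apply H; left; reflexivity|].
  apply IH; intros y Hy; apply H; right; exact Hy.
Qed.

Lemma is_mdir_id : is_mdir (fun V => V) (fun V => mmul N V X).
Proof.
  intros i j Hi Hj V; split.
  - unfold flow, mmul.
    assert (H : forall l, (forall k, In k l -> (k < N)%nat) ->
      is_Cderive (fun s => Sum (k in l) Cmul (V i k) (expm N (mscale (RtoC s) X) k j))
                 (Sum (k in l) Cmul (V i k) (X k j))).
    { induction l as [|k l IH]; intros Hl; simpl; [apply is_Cderive_const|].
      apply is_Cderive_add; [|apply IH; intros; apply Hl; right; assumption].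
      pose proof (is_Cderive_mul _ _ _ _ (is_Cderive_const (V i k))
        (expm_derive N X k j (Hl k (or_introl eq_refl)) Hj)) as H.
      replace (Cmul (V i k) (X k j)) with
        (Cadd (Cmul C0 (expm N (mscale (RtoC 0) X) k j)) (Cmul (V i k) (X k j))) by ring.
      exact H. }
    apply H; intros k Hk; apply in_seq in Hk; lia.
  - unfold flow, mmul; rewrite <- (Csum_delta N (fun k => V i k) j Hj).
    apply Csum_ext; intros k Hk; apply in_seq in Hk.
    rewrite expm_0 by lia; unfold mid; rewrite (Nat.eqb_sym j k); ring.
Qed.

Lemma is_mdir_const A : is_mdir (fun _ => A) (fun _ => mzero).
Proof. intros i j _ _; apply is_dir_const. Qed.

Lemma is_mdir_add F G F' G' : is_mdir F F' -> is_mdir G G' ->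
  is_mdir (fun V => madd (F V) (G V)) (fun V => madd (F' V) (G' V)).
Proof. intros HF HG i j Hi Hj; apply is_dir_add; [apply HF|apply HG]; assumption. Qed.

Lemma is_mdir_mul F G F' G' : is_mdir F F' -> is_mdir G G' ->
  is_mdir (fun V => mmul N (F V) (G V))
          (fun V => madd (mmul N (F' V) (G V)) (mmul N (F V) (G' V))).
Proof.
  intros HF HG i j Hi Hj; unfold mmul, madd.
  eapply is_dir_ext.
  - apply is_dir_sum with (G := fun k V =>
      Cadd (Cmul (F' V i k) (G V k j)) (Cmul (F V i k) (G' V k j))).
    intros k Hk; apply in_seq in Hk.
    apply (is_dir_mul (fun V => F V i k) (fun V => G V k j)); [apply HF|apply HG]; lia.
  - intros V; apply Csum_add.
Qed.

Lemma is_mdir_mul_const F F' A : is_mdir F F' ->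
  is_mdir (fun V => mmul N (F V) A) (fun V => mmul N (F' V) A).
Proof.
  intros HF i j Hi Hj.
  eapply is_dir_ext; [apply (is_mdir_mul _ _ _ _ HF (is_mdir_const A)); assumption|].
  intros V; unfold madd, mmul at 2.
  rewrite (Csum_ext _ (fun _ => C0)), Csum_zero by (intros; unfold mzero; ring); ring.
Qed.

Lemma is_dir_trace F G : is_mdir F G ->
  is_dir (fun V => ntr N (F V)) (fun V => ntr N (G V)).
Proof.
  intros H; apply is_dir_scale, is_dir_sum; intros i Hi; apply in_seq in Hi.
  apply H; lia.
Qed.

(** This is the sum of V^m X V^(k-m) over 1 <= m <= k, written along the recursion of [mpow] so that
    the product rule produces it directly. *)
Fixpoint dpow (V : Mat) (k : nat) : Mat :=
  match k with
  | O => mzero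
  | S k => madd (mmul N (mmul N V X) (mpow N V k)) (mmul N V (dpow V k))
  end.

(** The literal derivative of [dpow]; its two equal mixed terms account later for the factor 2 in
    D. *)
Fixpoint ddpow (V : Mat) (k : nat) : Mat :=
  match k with
  | O => mzero
  | S k => madd
      (madd (mmul N (mmul N (mmul N V X) X) (mpow N V k)) (mmul N (mmul N V X) (dpow V k)))
      (madd (mmul N (mmul N V X) (dpow V k)) (mmul N V (ddpow V k)))
  end.

Lemma is_mdir_mpow k : is_mdir (fun V => mpow N V k) (fun V => dpow V k).
Proof.
  induction k as [|k IH]; simpl; [apply is_mdir_const|].
  apply is_mdir_mul; [apply is_mdir_id|exact IH].
Qed.

Lemma is_mdir_dpow k : is_mdir (fun V => dpow V k) (fun V => ddpow V k).
Proof.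
  induction k as [|k IH]; simpl; [apply is_mdir_const|].
  apply is_mdir_add; apply is_mdir_mul;
    try apply is_mdir_mpow; try exact IH; try apply is_mdir_mul_const; apply is_mdir_id.
Qed.

Definition vtr (V : Mat) (j : nat) : C := ntr N (mpow N V j).
Definition dtr (V : Mat) (j : nat) : C := ntr N (dpow V j).
Definition ddtr (V : Mat) (j : nat) : C := ntr N (ddpow V j).

Fixpoint meval (V : Mat) (k : nat) (l : list nat) (a b : nat) : C :=
  match l with
  | [] => mpow N V k a b
  | j :: l => Cmul (vtr V j) (meval V k l a b)
  end.

Fixpoint dmeval (V : Mat) (k : nat) (l : list nat) (a b : nat) : C :=
  match l with
  | [] => dpow V k a b
  | j :: l => Cadd (Cmul (dtr V j) (meval V k l a b)) (Cmul (vtr V j) (dmeval V k l a b))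
  end.

Fixpoint ddmeval (V : Mat) (k : nat) (l : list nat) (a b : nat) : C :=
  match l with
  | [] => ddpow V k a b
  | j :: l => Cadd
      (Cadd (Cmul (ddtr V j) (meval V k l a b)) (Cmul (dtr V j) (dmeval V k l a b)))
      (Cadd (Cmul (dtr V j) (dmeval V k l a b)) (Cmul (vtr V j) (ddmeval V k l a b)))
  end.

Lemma is_mdir_meval k l : is_mdir (fun V => meval V k l) (fun V => dmeval V k l).
Proof.
  intros a b Ha Hb; induction l as [|j l IH]; simpl; [apply is_mdir_mpow; assumption|].
  apply is_dir_mul; [apply is_dir_trace, is_mdir_mpow|exact IH].
Qed.

Lemma is_mdir_dmeval k l : is_mdir (fun V => dmeval V k l) (fun V => ddmeval V k l).
Proof.
  intros a b Ha Hb; induction l as [|j l IH]; simpl; [apply is_mdir_dpow; assumption|].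
  apply is_dir_add; apply is_dir_mul; try exact IH; try (apply is_mdir_meval; assumption);
    apply is_dir_trace; try apply is_mdir_mpow; apply is_mdir_dpow.
Qed.

End Directional.

(** * Sums over an orthonormal basis *)

Lemma Csum_list_prod {S T} (f : S * T -> C) l l' :
  (Sum (I in list_prod l l') f I) = (Sum (x in l) Sum (y in l') f (x, y)).
Proof.
  induction l as [|x l IH]; simpl; [reflexivity|].
  rewrite Csum_app, map_map, IH; reflexivity.
Qed.

Lemma Csum_RtoC_zero {T} (f : T -> R) l :
  (forall x, In x l -> 0 <= f x) -> (Sum (x in l) RtoC (f x)) = C0 ->
  forall x, In x l -> f x = 0.
Proof.
  intros Hpos H.
  assert (H' : fst (Sum (x in l) RtoC (f x)) = 0) by (rewrite H; reflexivity); clear H.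
  induction l as [|y l IH]; [contradiction|]; simpl in H'.
  assert (0 <= fst (Sum (x in l) RtoC (f x))).
  { clear - Hpos; assert (Hl : forall x, In x l -> 0 <= f x)
      by (intros x Hx; apply Hpos; right; exact Hx); clear Hpos.
    induction l as [|z l IH]; simpl; [lra|].
    specialize (IH (fun x Hx => Hl x (or_intror Hx))).
    specialize (Hl z (or_introl eq_refl)); lra. }
  pose proof (Hpos y (or_introl eq_refl)).
  intros x [<-|Hx]; [lra|].
  apply IH; [|lra|exact Hx]; intros z Hz; apply Hpos; right; exact Hz.
Qed.

(* [P] is idempotent of trace [n], so [I - P] is Hermitian with
   [Tr ((I - P) (I - P)^* ) = Tr (I - P) = 0]. *)
Lemma biorthogonal_complete {T} n (Is : list T) (d : T -> T -> C) (x y : nat -> T -> C) :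
  let P I J := Sum (a in seq 0 n) Cmul (x a I) (y a J) in
  length Is = n ->
  (forall I f, In I Is -> (Sum (J in Is) Cmul (d I J) (f J)) = f I) ->
  (forall I, d I I = C1) -> (forall I J, d I J = d J I) ->
  (forall I J, Cconj (d I J) = d I J) ->
  (forall I J, In I Is -> In J Is -> Cconj (P I J) = P J I) ->
  (forall a b, (a < n)%nat -> (b < n)%nat ->
    (Sum (I in Is) Cmul (x a I) (y b I)) = if Nat.eqb a b then C1 else C0) ->
  forall I J, In I Is -> In J Is -> P I J = d I J.
Proof.
  intros P Hn Hd Hd1 Hsym Hreal Hherm Horth.
  set (Q := fun I J => Cadd (d I J) (Copp (P I J))).
  assert (HPP : forall I, (Sum (J in Is) Cmul (P I J) (P J I)) = P I I).
  { intros I.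
    transitivity (Sum (J in Is) Sum (a in seq 0 n) Sum (b in seq 0 n)
      Cmul (Cmul (x a I) (y b I)) (Cmul (x b J) (y a J))).
    { apply Csum_ext; intros J _; unfold P at 1; rewrite <- Csum_mul_r.
      apply Csum_ext; intros a _; unfold P; rewrite <- Csum_mul_l.
      apply Csum_ext; intros b _; ring. }
    rewrite Csum_exchange; apply Csum_ext; intros a Ha; apply in_seq in Ha.
    rewrite Csum_exchange.
    rewrite <- (Csum_delta n (fun b => Cmul (x a I) (y b I)) a) by lia.
    apply Csum_ext; intros b Hb; apply in_seq in Hb.
    rewrite Csum_mul_l, Horth, Nat.eqb_sym by lia; ring. }
  assert (HQQ : forall I, In I Is ->
    (Sum (J in Is) Cmul (Q I J) (Q J I)) = Cadd C1 (Copp (P I I))).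
  { intros I HI.
    transitivity (Sum (J in Is) Cadd
      (Cmul (d I J) (Cadd (d J I) (Copp (Cadd (P J I) (P I J))))) (Cmul (P I J) (P J I))).
    { apply Csum_ext; intros J _; unfold Q; rewrite (Hsym J I); ring. }
    rewrite Csum_add, HPP, (Hd I (fun J => Cadd (d J I) (Copp (Cadd (P J I) (P I J))))),
      Hd1 by exact HI; ring. }
  (* The counting step: the trace of the identity is the number of indices and the trace of P is the
     number of vectors, and both equal n. *)
  assert (Htr : (Sum (I in Is) Sum (J in Is) Cmul (Q I J) (Q J I)) = C0).
  { rewrite (Csum_ext _ (fun I => Cadd C1 (Cmul (Copp C1) (P I I))))
      by (intros I HI; rewrite HQQ by exact HI; ring).
    rewrite Csum_add, Csum_mul_l, Csum_one, Hn; unfold P.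
    rewrite Csum_exchange, (Csum_ext _ (fun _ => C1)).
    - rewrite Csum_one, length_seq; ring.
    - intros a Ha; apply in_seq in Ha; rewrite Horth, Nat.eqb_refl by lia; reflexivity. }
  rewrite <- Csum_list_prod with (f := fun p => Cmul (Q (fst p) (snd p)) (Q (snd p) (fst p)))
    in Htr.
  intros I J HI HJ.
  (* As Q is Hermitian, the vanishing trace is a sum of squared moduli of its entries, so each of
     them is zero. *)
  assert (HQ : fst (Q I J) * fst (Q I J) + snd (Q I J) * snd (Q I J) = 0).
  { apply (Csum_RtoC_zero (fun p => fst (Q (fst p) (snd p)) * fst (Q (fst p) (snd p))
      + snd (Q (fst p) (snd p)) * snd (Q (fst p) (snd p))) (list_prod Is Is))
      with (x := (I, J)).
    - intros p _; nra.
    - rewrite <- Htr; apply Csum_ext; intros [K L] HKL; apply in_prod_iff in HKL.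
      simpl; assert (HQ : Q L K = Cconj (Q K L)).
      { unfold Q; rewrite (Hsym L K), <- (Hherm K L), <- (Hreal K L) at 1 by tauto.
        apply C_ext; simpl; ring. }
      rewrite HQ; apply C_ext; simpl; ring.
    - apply in_prod; assumption. }
  assert (H : Q I J = C0) by (apply Rplus_sqr_eq_0 in HQ as [? ?]; apply C_ext; assumption).
  transitivity (Cadd (d I J) (Copp (Q I J))); [unfold Q; ring|rewrite H; ring].
Qed.

Lemma Csum_nth (B : list Mat) (f : Mat -> C) :
  (Sum (X in B) f X) = (Sum (a in seq 0 (length B)) f (nth a B mzero)).
Proof.
  induction B as [|X B IH]; simpl; [reflexivity|].
  rewrite IH, <- seq_shift, map_map; reflexivity.
Qed.

Lemma Cconj_add a b : Cconj (Cadd a b) = Cadd (Cconj a) (Cconj b).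
Proof. apply C_ext; simpl; ring. Qed.

Lemma Cconj_mul a b : Cconj (Cmul a b) = Cmul (Cconj a) (Cconj b).
Proof. apply C_ext; simpl; ring. Qed.

Lemma Cconj_sum {T} (f : T -> C) l : Cconj (Sum (x in l) f x) = (Sum (x in l) Cconj (f x)).
Proof.
  induction l as [|x l IH]; simpl; [apply C_ext; simpl; ring|].
  rewrite Cconj_add, IH; reflexivity.
Qed.

(** Skew-hermitian X turns X^* Y into - X Y, and Tr(X Y) is real because conjugation only exchanges
    the two summation indices. So the real inner product equals a complex bilinear pairing. *)
Lemma skew_pairing N X Y : skew_hermitian N X -> skew_hermitian N Y ->
  Cmul (RtoC (- INR N)) (Sum (i in seq 0 N) Sum (j in seq 0 N) Cmul (X i j) (Y j i))
  = RtoC (inner N X Y).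
Proof.
  intros HX HY; unfold inner, mtrace, mmul.
  set (tau := Sum (i in seq 0 N) Sum (j in seq 0 N) Cmul (X i j) (Y j i)).
  assert (H : (Sum (i in seq 0 N) Sum (k in seq 0 N) Cmul (madj X i k) (Y k i)) = Copp tau).
  { transitivity (Cmul (Copp C1) tau); [|ring]; unfold tau.
    rewrite <- Csum_mul_l; apply Csum_ext; intros i Hi; rewrite <- Csum_mul_l.
    apply Csum_ext; intros k Hk; apply in_seq in Hi, Hk.
    rewrite (HX i k) by lia; unfold madj; ring. }
  rewrite H.
  assert (Hc : Cconj tau = tau).
  { unfold tau; rewrite Cconj_sum, Csum_exchange.
    apply Csum_ext; intros i Hi; rewrite Cconj_sum.
    apply Csum_ext; intros k Hk; apply in_seq in Hi, Hk.
    rewrite (HX k i), (HY i k), Cconj_mul by lia; apply C_ext; simpl; ring. }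
  assert (Hs : snd tau = 0) by (apply (f_equal snd) in Hc; simpl in Hc; lra).
  apply C_ext; simpl; rewrite Hs; ring.
Qed.

Section Basis.
Variables (N : nat) (B : list Mat).
Hypotheses (HN : (1 <= N)%nat) (HB : onb_uN N B).

Lemma Csum_mid i (f : nat -> C) : (i < N)%nat ->
  (Sum (k in seq 0 N) Cmul (mid i k) (f k)) = f i.
Proof. apply Csum_delta. Qed.

Lemma mid_sym i j : mid i j = mid j i.
Proof. unfold mid; rewrite Nat.eqb_sym; reflexivity. Qed.

Lemma basis_skew a : (a < N * N)%nat -> skew_hermitian N (nth a B mzero).
Proof.
  intros Ha; destruct HB as [Hlen [Hskew _]].
  rewrite Forall_forall in Hskew; apply Hskew, nth_In; rewrite Hlen; exact Ha.
Qed.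

Lemma basis_complete i j k l :
  (i < N)%nat -> (j < N)%nat -> (k < N)%nat -> (l < N)%nat ->
  (Sum (X in B) Cmul (X i j) (X k l)) = Cmul (RtoC (- / INR N)) (Cmul (mid i l) (mid j k)).
Proof.
  intros Hi Hj Hk Hl; destruct HB as [Hlen [Hskew Horth]].
  assert (HNR : INR N <> 0) by (apply not_0_INR; lia).
  set (grid := list_prod (seq 0 N) (seq 0 N)).
  set (d := fun I J : nat * nat => Cmul (mid (fst I) (fst J)) (mid (snd I) (snd J))).
  set (x := fun a (I : nat * nat) => nth a B mzero (fst I) (snd I)).
  (* By [skew_pairing], - N times the transpose of a basis matrix is its dual vector for the
     entrywise bilinear pairing, which turns orthonormality into biorthogonality. *)
  set (y := fun a (I : nat * nat) => Cmul (RtoC (- INR N)) (nth a B mzero (snd I) (fst I))).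
  assert (Hgrid : forall I, In I grid -> (fst I < N)%nat /\ (snd I < N)%nat).
  { intros [a b] H; apply in_prod_iff in H; rewrite !in_seq in H; simpl; lia. }
  assert (Hin : forall a b, (a < N)%nat -> (b < N)%nat -> In (a, b) grid)
    by (intros; apply in_prod; apply in_seq; lia).
  pose proof (biorthogonal_complete (N * N) grid d x y) as H; cbv zeta in H.
  specialize (H ltac:(unfold grid; rewrite length_prod, length_seq; reflexivity)).
  (* The transpose in [y] is why the second pair is (l, k); the delta there reads delta_il
     delta_jk. *)
  assert (H1 : (Sum (a in seq 0 (N * N)) Cmul (x a (i, j)) (y a (l, k))) = d (i, j) (l, k)).
  { apply H; try (apply Hin; assumption); clear H.
    - intros [a b] f HI; apply Hgrid in HI; simpl in HI; unfold grid.
      rewrite Csum_list_prod; unfold d; simpl.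
      rewrite <- (Csum_mid a (fun a' => f (a', b))) by tauto.
      apply Csum_ext; intros a' _.
      rewrite <- (Csum_mid b (fun b' => f (a', b'))) by tauto.
      rewrite <- Csum_mul_l; apply Csum_ext; intros b' _; ring.
    - intros [a b]; unfold d, mid; simpl; rewrite !Nat.eqb_refl; ring.
    - intros [a b] [a' b']; unfold d; simpl; rewrite (mid_sym a), (mid_sym b); reflexivity.
    - intros [a b] [a' b']; unfold d, mid; simpl.
      destruct (Nat.eqb a a'), (Nat.eqb b b'); apply C_ext; simpl; ring.
    - intros [a b] [a' b'] HI HJ; apply Hgrid in HI, HJ; simpl in HI, HJ.
      rewrite Cconj_sum; apply Csum_ext; intros c Hc; apply in_seq in Hc.
      pose proof (basis_skew c ltac:(lia)) as Hs.
      unfold x, y; simpl; rewrite (Hs a b), (Hs b' a') by tauto.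
      apply C_ext; simpl; ring.
    - intros a b Ha Hb; unfold grid; rewrite Csum_list_prod; unfold x, y; simpl.
      transitivity (RtoC (inner N (nth a B mzero) (nth b B mzero))).
      + rewrite <- skew_pairing by (apply basis_skew; assumption).
        rewrite <- Csum_mul_l; apply Csum_ext; intros i' _.
        rewrite <- Csum_mul_l; apply Csum_ext; intros j' _; ring.
      + rewrite Horth by assumption; destruct (Nat.eqb a b); reflexivity. }
  rewrite Csum_nth, Hlen.
  transitivity (Cmul (RtoC (- / INR N)) (d (i, j) (l, k))); [|reflexivity].
  rewrite <- H1, <- Csum_mul_l; apply Csum_ext; intros a _; unfold x, y; simpl.
  apply C_ext; simpl; field; exact HNR.
Qed.

(** * Matrix algebra and contractions over the basis *)

Lemma mmul_assoc A1 A2 A3 : mmul N A1 (mmul N A2 A3) = mmul N (mmul N A1 A2) A3.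
Proof.
  apply functional_extensionality; intros i; apply functional_extensionality; intros j.
  unfold mmul.
  transitivity (Sum (k in seq 0 N) Sum (m in seq 0 N)
    Cmul (Cmul (A1 i k) (A2 k m)) (A3 m j)).
  - apply Csum_ext; intros k _; rewrite <- Csum_mul_l; apply Csum_ext; intros; ring.
  - rewrite Csum_exchange; apply Csum_ext; intros m _; apply Csum_mul_r.
Qed.

Lemma mmul_ext_in A1 A1' A2 A2' i j :
  (forall k, (k < N)%nat -> A1 i k = A1' i k) -> (forall k, (k < N)%nat -> A2 k j = A2' k j) ->
  mmul N A1 A2 i j = mmul N A1' A2' i j.
Proof.
  intros H1 H2; apply Csum_ext; intros k Hk; apply in_seq in Hk.
  rewrite H1, H2 by lia; reflexivity.
Qed.

Lemma mmul_mid_l A i j : (i < N)%nat -> mmul N mid A i j = A i j.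
Proof. intros Hi; apply (Csum_mid i (fun k => A k j) Hi). Qed.

Lemma mpow_add V a b i j : (i < N)%nat ->
  mmul N (mpow N V a) (mpow N V b) i j = mpow N V (a + b) i j.
Proof.
  revert i; induction a as [|a IH]; intros i Hi; simpl; [apply mmul_mid_l, Hi|].
  rewrite <- mmul_assoc; apply mmul_ext_in; intros k Hk; [reflexivity|apply IH, Hk].
Qed.

Lemma mpow_succ_r V a i j : (i < N)%nat -> (j < N)%nat ->
  mmul N (mpow N V a) V i j = mpow N V (S a) i j.
Proof.
  intros Hi Hj; rewrite <- Nat.add_1_r, <- mpow_add by exact Hi.
  apply mmul_ext_in; intros k Hk; [reflexivity|symmetry; apply mpow_1, Hj].
Qed.

Lemma ntr_ext A A' : (forall i, (i < N)%nat -> A i i = A' i i) -> ntr N A = ntr N A'.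
Proof.
  intros H; unfold ntr; f_equal; apply Csum_ext; intros i Hi; apply in_seq in Hi.
  apply H; lia.
Qed.

Lemma ntr_mul_comm A A' : ntr N (mmul N A A') = ntr N (mmul N A' A).
Proof.
  unfold ntr, mtrace, mmul; f_equal; rewrite Csum_exchange.
  apply Csum_ext; intros; apply Csum_ext; intros; ring.
Qed.

Lemma ntr_add A A' : ntr N (madd A A') = Cadd (ntr N A) (ntr N A').
Proof. unfold ntr, mtrace, madd; rewrite Csum_add; ring. Qed.

Lemma mmul_add_r A A1 A2 i j :
  mmul N A (madd A1 A2) i j = Cadd (mmul N A A1 i j) (mmul N A A2 i j).
Proof.
  unfold mmul, madd; rewrite <- Csum_add; apply Csum_ext; intros; ring.
Qed.

Lemma ntr_mid : ntr N mid = C1.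
Proof.
  unfold ntr, mtrace; rewrite (Csum_ext _ (fun _ => C1)).
  - rewrite Csum_one, length_seq; apply C_ext; simpl; field; apply not_0_INR; lia.
  - intros i _; unfold mid; rewrite Nat.eqb_refl; reflexivity.
Qed.

Lemma mmul_sum_l A (F : Mat -> Mat) i j :
  (Sum (X in B) mmul N A (F X) i j) = mmul N A (fun a b => Sum (X in B) F X a b) i j.
Proof.
  unfold mmul; rewrite Csum_exchange; apply Csum_ext; intros k _; apply Csum_mul_l.
Qed.

Lemma mmul_sum_r A (F : Mat -> Mat) i j :
  (Sum (X in B) mmul N (F X) A i j) = mmul N (fun a b => Sum (X in B) F X a b) A i j.
Proof.
  unfold mmul; rewrite Csum_exchange; apply Csum_ext; intros k _; apply Csum_mul_r.
Qed.

Lemma mmul_scale_l c A A' i j : mmul N (mscale c A) A' i j = Cmul c (mmul N A A' i j).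
Proof. unfold mmul, mscale; rewrite <- Csum_mul_l; apply Csum_ext; intros; ring. Qed.

Lemma mmul_scale_r c A A' i j : mmul N A (mscale c A') i j = Cmul c (mmul N A A' i j).
Proof. unfold mmul, mscale; rewrite <- Csum_mul_l; apply Csum_ext; intros; ring. Qed.

Lemma basis_contract M i j : (i < N)%nat -> (j < N)%nat ->
  (Sum (X in B) mmul N X (mmul N M X) i j) = Cmul (Copp (ntr N M)) (mid i j).
Proof.
  intros Hi Hj.
  transitivity (Sum (b in seq 0 N) Sum (c in seq 0 N)
    Cmul (mid b c) (Cmul (Cmul (RtoC (- / INR N)) (mid i j)) (M b c))).
  - unfold mmul; rewrite Csum_exchange; apply Csum_ext; intros b Hb; apply in_seq in Hb.
    transitivity (Sum (X in B) Sum (c in seq 0 N) Cmul (M b c) (Cmul (X i b) (X c j))).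
    { apply Csum_ext; intros X _; rewrite <- Csum_mul_l; apply Csum_ext; intros; ring. }
    rewrite Csum_exchange; apply Csum_ext; intros c Hc; apply in_seq in Hc.
    rewrite Csum_mul_l, basis_complete by lia; ring.
  - rewrite (Csum_ext _ (fun b => Cmul (Cmul (RtoC (- / INR N)) (mid i j)) (M b b))).
    + rewrite Csum_mul_l; unfold ntr, mtrace.
      replace (RtoC (- / INR N)) with (Copp (RtoC (/ INR N))) by (apply C_ext; simpl; ring).
      ring.
    + intros b Hb; apply in_seq in Hb.
      apply (Csum_mid b (fun c => Cmul (Cmul (RtoC (- / INR N)) (mid i j)) (M b c))); lia.
Qed.

Lemma basis_sandwich A M K i j :
  (Sum (X in B) mmul N (mmul N A X) (mmul N M (mmul N X K)) i j)
  = Cmul (Copp (ntr N M)) (mmul N A K i j).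
Proof.
  rewrite (Csum_ext _ (fun X => mmul N A (mmul N (mmul N X (mmul N M X)) K) i j))
    by (intros X _; rewrite !mmul_assoc; reflexivity).
  rewrite mmul_sum_l, <- mmul_scale_r.
  apply mmul_ext_in; intros k Hk; [reflexivity|].
  rewrite mmul_sum_r; unfold mscale; rewrite <- (mmul_mid_l K k j Hk), <- mmul_scale_l.
  apply mmul_ext_in; intros k' Hk'; [|reflexivity].
  apply basis_contract; assumption.
Qed.

(** The case M = I, where the normalized trace is 1: both derivatives hit the same letter. This is
    the source of - k u^k. *)
Lemma basis_sandwich_mid A K i j :
  (Sum (X in B) mmul N (mmul N (mmul N A X) X) K i j) = Copp (mmul N A K i j).
Proof.
  transitivity (Cmul (Copp (ntr N mid)) (mmul N A K i j)); [|rewrite ntr_mid; ring].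
  rewrite <- basis_sandwich; apply Csum_ext; intros X _; rewrite <- mmul_assoc.
  apply mmul_ext_in; intros k Hk; [reflexivity|symmetry; apply mmul_mid_l, Hk].
Qed.

(** One factor 1/N comes from completeness and the other from the normalization of the trace. *)
Lemma basis_trace M i j : (i < N)%nat -> (j < N)%nat ->
  (Sum (X in B) Cmul (ntr N (mmul N X M)) (X i j))
  = Cmul (RtoC (- / (INR N * INR N))) (M i j).
Proof.
  intros Hi Hj.
  transitivity (Cmul (RtoC (- / (INR N * INR N))) (Sum (a in seq 0 N) Sum (b in seq 0 N)
    Cmul (mid j a) (Cmul (mid i b) (M b a)))).
  - rewrite <- Csum_mul_l.
    transitivity (Sum (X in B) Sum (a in seq 0 N) Sum (b in seq 0 N)
      Cmul (Cmul (RtoC (/ INR N)) (M b a)) (Cmul (X a b) (X i j))).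
    { apply Csum_ext; intros X _; unfold ntr, mtrace, mmul.
      rewrite <- Csum_mul_l, <- Csum_mul_r; apply Csum_ext; intros a _.
      rewrite <- Csum_mul_l, <- Csum_mul_r; apply Csum_ext; intros; ring. }
    rewrite Csum_exchange; apply Csum_ext; intros a Ha; apply in_seq in Ha.
    rewrite Csum_exchange, <- Csum_mul_l; apply Csum_ext; intros b Hb; apply in_seq in Hb.
    rewrite Csum_mul_l, basis_complete, (mid_sym a j), (mid_sym b i) by lia.
    replace (RtoC (- / (INR N * INR N))) with (Cmul (RtoC (/ INR N)) (RtoC (- / INR N))).
    + ring.
    + apply C_ext; simpl; field; apply not_0_INR; lia.
  - f_equal; rewrite (Csum_ext _ (fun a => Cmul (mid j a) (M i a))).
    + apply (Csum_mid j (fun a => M i a) Hj).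
    + intros a _; rewrite Csum_mul_l, (Csum_mid i (fun b => M b a) Hi); reflexivity.
Qed.

Lemma mmul_scaled_sum_l (c : Mat -> C) A (F : Mat -> Mat) i j :
  (Sum (X in B) Cmul (c X) (mmul N A (F X) i j))
  = mmul N A (fun a b => Sum (X in B) Cmul (c X) (F X a b)) i j.
Proof.
  rewrite <- (mmul_sum_l A (fun X => mscale (c X) (F X))); apply Csum_ext; intros X _.
  symmetry; apply mmul_scale_r.
Qed.

(** At each of the l places where X can stand in V^l, the contraction replaces it by a multiple of
    V^k, and powers of V commute. *)
Lemma basis_trace_dpow V k l i j : (i < N)%nat -> (j < N)%nat ->
  (Sum (X in B) Cmul (ntr N (mmul N X (mpow N V k))) (dpow N X V l i j))
  = Cmul (RtoC (- / (INR N * INR N) * INR l)) (mpow N V (k + l) i j).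
Proof.
  intros Hi Hj; revert i Hi; induction l as [|l IH]; intros i Hi.
  - simpl; rewrite (Csum_ext _ (fun _ => C0)), Csum_zero by (intros; unfold mzero; ring).
    apply C_ext; simpl; ring.
  - simpl dpow; unfold madd.
    rewrite (Csum_ext _ (fun X => Cadd
      (Cmul (ntr N (mmul N X (mpow N V k))) (mmul N V (mmul N X (mpow N V l)) i j))
      (Cmul (ntr N (mmul N X (mpow N V k))) (mmul N V (dpow N X V l) i j))))
      by (intros X _; rewrite <- mmul_assoc; ring).
    rewrite Csum_add, !mmul_scaled_sum_l.
    transitivity (Cadd
      (mmul N V (mscale (RtoC (- / (INR N * INR N))) (mpow N V (k + l))) i j)
      (mmul N V (mscale (RtoC (- / (INR N * INR N) * INR l)) (mpow N V (k + l))) i j)).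
    + f_equal; apply mmul_ext_in; intros m Hm; try reflexivity; [|apply IH, Hm].
      unfold mscale; rewrite <- mpow_add, <- mmul_scale_l by exact Hm.
      transitivity (Sum (X in B)
        mmul N (mscale (ntr N (mmul N X (mpow N V k))) X) (mpow N V l) m j).
      { apply Csum_ext; intros X _; symmetry; apply mmul_scale_l. }
      rewrite (mmul_sum_r _ (fun X => mscale (ntr N (mmul N X (mpow N V k))) X)).
      apply mmul_ext_in; intros m' Hm'; [|reflexivity].
      apply basis_trace; assumption.
    + rewrite !mmul_scale_r.
      replace (k + S l)%nat with (S (k + l)) by lia; simpl mpow; rewrite S_INR.
      apply C_ext; simpl; ring.
Qed.

(** By cyclicity all k places of X give the same trace. The prefix V^a is there for the induction,
    since unfolding [dpow] moves one V to the left. *)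
Lemma ntr_mpow_dpow X V a k :
  ntr N (mmul N (mpow N V a) (dpow N X V k))
  = Cmul (RtoC (INR k)) (ntr N (mmul N X (mpow N V (a + k)))).
Proof.
  revert a; induction k as [|k IH]; intros a.
  - unfold ntr at 1, mtrace; rewrite (Csum_ext _ (fun _ => C0)), Csum_zero.
    + apply C_ext; simpl; ring.
    + intros i _; unfold mmul; simpl.
      rewrite (Csum_ext _ (fun _ => C0)), Csum_zero by (intros; unfold mzero; ring); ring.
  - transitivity (Cadd (ntr N (mmul N (mmul N (mpow N V a) V) (mmul N X (mpow N V k))))
      (ntr N (mmul N (mpow N V (S a)) (dpow N X V k)))).
    + rewrite <- ntr_add; apply ntr_ext; intros i Hi; simpl dpow.
      rewrite mmul_add_r; unfold madd; rewrite !mmul_assoc; f_equal.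
      apply mmul_ext_in; intros m Hm; [apply mpow_succ_r; assumption|reflexivity].
    + rewrite IH, ntr_mul_comm, <- mmul_assoc.
      replace (a + S k)%nat with (S a + k)%nat by lia.
      rewrite (ntr_ext _ (mmul N X (mpow N V (S a + k)))).
      * rewrite S_INR; apply C_ext; simpl; ring.
      * intros i Hi; apply mmul_ext_in; intros m Hm; [reflexivity|].
        replace (S a + k)%nat with (k + S a)%nat by lia.
        rewrite <- mpow_add by exact Hm.
        apply mmul_ext_in; intros m' Hm'; [reflexivity|apply mpow_succ_r; assumption].
Qed.

Lemma dtr_eq X V k : dtr N X V k = Cmul (RtoC (INR k)) (ntr N (mmul N X (mpow N V k))).
Proof.
  transitivity (ntr N (mmul N (mpow N V 0) (dpow N X V k))); [|apply ntr_mpow_dpow].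
  apply ntr_ext; intros i Hi; symmetry; apply mmul_mid_l, Hi.
Qed.

Lemma basis_dtr_dpow V j k a b : (a < N)%nat -> (b < N)%nat ->
  (Sum (X in B) Cmul (dtr N X V j) (dpow N X V k a b))
  = Cmul (RtoC (- / (INR N * INR N))) (Cmul (RtoC (INR j * INR k)) (mpow N V (j + k) a b)).
Proof.
  intros Ha Hb.
  rewrite (Csum_ext _ (fun X => Cmul (RtoC (INR j))
    (Cmul (ntr N (mmul N X (mpow N V j))) (dpow N X V k a b))))
    by (intros; rewrite dtr_eq; ring).
  rewrite Csum_mul_l, basis_trace_dpow by assumption; apply C_ext; simpl; ring.
Qed.

Lemma basis_dtr_dtr V j k :
  (Sum (X in B) Cmul (dtr N X V j) (dtr N X V k))
  = Cmul (RtoC (- / (INR N * INR N))) (Cmul (RtoC (INR j * INR k)) (vtr N V (j + k))).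
Proof.
  unfold dtr at 2, vtr, ntr, mtrace.
  transitivity (Sum (X in B) Sum (a in seq 0 N)
    Cmul (RtoC (/ INR N)) (Cmul (dtr N X V j) (dpow N X V k a a))).
  { apply Csum_ext; intros X _; rewrite <- !Csum_mul_l; apply Csum_ext; intros; ring. }
  rewrite Csum_exchange, <- !Csum_mul_l; apply Csum_ext; intros a Ha; apply in_seq in Ha.
  rewrite Csum_mul_l, basis_dtr_dpow by lia; ring.
Qed.

(** The pair of X encloses V^(b+k-m), which becomes a trace, and V^(m+1) remains outside. The gap
    V^b is general because each unfolding of [dpow] pushes one more V between the two X. *)
Lemma basis_mixed V b k i j : (i < N)%nat -> (j < N)%nat ->
  (Sum (X in B) mmul N (mmul N V X) (mmul N (mpow N V b) (dpow N X V k)) i j)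
  = Copp (Sum (m in seq 0 k) Cmul (vtr N V (b + k - m)) (mpow N V (S m) i j)).
Proof.
  intros Hi Hj; revert b; induction k as [|k IH]; intros b.
  - simpl; rewrite (Csum_ext _ (fun _ => C0)), Csum_zero; [ring|].
    intros X _; unfold mmul at 1.
    rewrite (Csum_ext _ (fun _ => C0)), Csum_zero; [reflexivity|].
    intros m _; unfold mmul at 2.
    rewrite (Csum_ext _ (fun _ => C0)), Csum_zero by (intros; unfold mzero; ring); ring.
  - rewrite (Csum_ext _ (fun X => Cadd
      (mmul N (mmul N V X) (mmul N (mmul N (mpow N V b) V) (mmul N X (mpow N V k))) i j)
      (mmul N (mmul N V X) (mmul N (mpow N V (S b)) (dpow N X V k)) i j))).
    + rewrite Csum_add, basis_sandwich, IH, Csum_seq_S.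
      rewrite (ntr_ext _ (mpow N V (S b))) by (intros; apply mpow_succ_r; assumption).
      replace (b + S k)%nat with (S b + k)%nat by lia.
      replace (S b + k - k)%nat with (S b) by lia.
      unfold vtr; simpl mpow; ring.
    + intros X _; rewrite <- mmul_add_r; apply mmul_ext_in; intros m Hm; [reflexivity|].
      simpl dpow; rewrite mmul_add_r; unfold madd; rewrite !mmul_assoc; f_equal.
      apply mmul_ext_in; intros m' Hm'; [apply mpow_succ_r; assumption|reflexivity].
Qed.

(** The value of [Du] at V. Of the pairs of letters in V^k, exactly m enclose V^(k-m), and 2 counts
    the orders of differentiation. Starting at m = 0, with weight zero, suits the recursion on k. *)
Definition lap_pow (V : Mat) (k i j : nat) : C :=
  Cadd (Cmul (RtoC (- INR k)) (mpow N V k i j))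
       (Cmul (RtoC (-2)) (Sum (m in seq 0 k)
          Cmul (RtoC (INR m)) (Cmul (vtr N V (k - m)) (mpow N V m i j)))).

(** Splitting off the leading V of V^(k+1) leaves three cases: both derivatives on it, one on it and
    one on V^k (twice [basis_mixed]), or both on V^k (the induction hypothesis multiplied by V). *)
Lemma basis_ddpow V k i j : (i < N)%nat -> (j < N)%nat ->
  (Sum (X in B) ddpow N X V k i j) = lap_pow V k i j.
Proof.
  intros Hi Hj; revert i Hi; induction k as [|k IH]; intros i Hi.
  - simpl; unfold mzero; rewrite Csum_zero; unfold lap_pow; apply C_ext; simpl; ring.
  - rewrite (Csum_ext _ (fun X => Cadd (Cadd
      (mmul N (mmul N (mmul N V X) X) (mpow N V k) i j)
      (Cmul (RtoC 2) (mmul N (mmul N V X) (mmul N (mpow N V 0) (dpow N X V k)) i j)))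
      (mmul N V (ddpow N X V k) i j))).
    + rewrite !Csum_add, Csum_mul_l, basis_sandwich_mid, basis_mixed by assumption.
      rewrite (mmul_sum_l V (fun X => ddpow N X V k)).
      rewrite (mmul_ext_in V V _ (lap_pow V k) i j (fun _ _ => eq_refl) IH).
      replace (mmul N V (lap_pow V k) i j) with
        (Cadd (Cmul (RtoC (- INR k)) (mpow N V (S k) i j))
          (Cmul (RtoC (-2)) (Sum (m in seq 0 k)
             Cmul (RtoC (INR m)) (Cmul (vtr N V (k - m)) (mpow N V (S m) i j))))).
      * unfold lap_pow; rewrite Nat.add_0_l.
        (* After the shift the weight m + 1 splits: m comes from the induction hypothesis and 1 from
           the mixed terms. *)
        rewrite Csum_seq_shift.
        rewrite (Csum_ext (fun m => Cmul (RtoC (INR (S m))) _) (fun m => Cadd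
          (Cmul (vtr N V (k - m)) (mpow N V (S m) i j))
          (Cmul (RtoC (INR m)) (Cmul (vtr N V (k - m)) (mpow N V (S m) i j))))).
        { rewrite Csum_add.
          set (s1 := Sum (m in seq 0 k) Cmul (vtr N V (k - m)) _).
          set (s2 := Sum (m in seq 0 k) Cmul (RtoC (INR m)) _).
          rewrite S_INR; simpl mpow; apply C_ext; simpl; ring. }
        { intros m _; rewrite S_INR; apply C_ext; simpl; ring. }
      * unfold lap_pow; simpl mpow.
        rewrite (mmul_add_r V (mscale (RtoC (- INR k)) (mpow N V k))
          (mscale (RtoC (-2)) (fun a b => Sum (m in seq 0 k)
            Cmul (RtoC (INR m)) (Cmul (vtr N V (k - m)) (mpow N V m a b))))).
        rewrite !mmul_scale_r; f_equal; f_equal.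
        unfold mmul at 2.
        rewrite (Csum_ext (fun c => Cmul (V i c) _) (fun c => Sum (m in seq 0 k)
          Cmul (Cmul (RtoC (INR m)) (vtr N V (k - m))) (Cmul (V i c) (mpow N V m c j))))
          by (intros; rewrite <- Csum_mul_l; apply Csum_ext; intros; ring).
        rewrite Csum_exchange; apply Csum_ext; intros m _.
        rewrite Csum_mul_l; unfold mmul; ring.
    + intros X _; simpl ddpow; unfold madd.
      rewrite (mmul_ext_in (mmul N V X) (mmul N V X) (mmul N (mpow N V 0) (dpow N X V k))
        (dpow N X V k)) by (intros; try apply mmul_mid_l; auto).
      apply C_ext; simpl; ring.
Qed.

Definition lap_tr (V : Mat) (k : nat) : C :=
  Cadd (Cmul (RtoC (- INR k)) (vtr N V k))
       (Cmul (RtoC (-2)) (Sum (m in seq 0 k)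
          Cmul (RtoC (INR m)) (Cmul (vtr N V (k - m)) (vtr N V m)))).

(** The trace commutes with the sum over the basis, so each V^m in the formula for V^k becomes
    tr(V^m); condition (2) is condition (1) with u^m replaced by v_m. *)
Lemma basis_ddtr V k : (Sum (X in B) ddtr N X V k) = lap_tr V k.
Proof.
  unfold ddtr, ntr, mtrace; rewrite Csum_mul_l, Csum_exchange.
  rewrite (Csum_ext _ (fun a => lap_pow V k a a))
    by (intros a Ha; apply in_seq in Ha; apply basis_ddpow; lia).
  set (S := Sum (m in seq 0 k) Cmul (RtoC (INR m)) (Cmul (vtr N V (k - m))
    (Sum (a in seq 0 N) mpow N V m a a))).
  assert (HS : (Sum (a in seq 0 N) Sum (m in seq 0 k)
    Cmul (RtoC (INR m)) (Cmul (vtr N V (k - m)) (mpow N V m a a))) = S).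
  { rewrite Csum_exchange; apply Csum_ext; intros; rewrite !Csum_mul_l; reflexivity. }
  assert (HT : (Sum (m in seq 0 k)
    Cmul (RtoC (INR m)) (Cmul (vtr N V (k - m)) (vtr N V m))) = Cmul (RtoC (/ INR N)) S).
  { unfold S; rewrite <- Csum_mul_l; apply Csum_ext; intros.
    unfold vtr at 2, ntr, mtrace; ring. }
  unfold lap_pow, lap_tr; rewrite Csum_add, !Csum_mul_l, HS, HT.
  unfold vtr, ntr, mtrace; ring.
Qed.

End Basis.

(** * Evaluation of polynomials at a matrix *)

Section Evaluation.
Variables (N : nat) (V : Mat).

(** In [tprod] the range of the product depends on the length of the list; a common bound makes
    different lists comparable factor by factor. *)
Definition vprod_upto (M : nat) (e : expo) : C :=
  fold_right Cmul C1
    (map (fun j => Cpow (ntr N (mpow N V j)) (nth j e 0%nat)) (seq 1 M)).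

Lemma fold_Cmul_app (l l' : list C) :
  fold_right Cmul C1 (l ++ l') = Cmul (fold_right Cmul C1 l) (fold_right Cmul C1 l').
Proof. induction l as [|c l IH]; simpl; [|rewrite IH]; ring. Qed.

Lemma fold_Cmul_one {T} (f : T -> C) l :
  (forall x, In x l -> f x = C1) -> fold_right Cmul C1 (map f l) = C1.
Proof.
  intros H; induction l as [|x l IH]; simpl; [reflexivity|].
  rewrite (H x (or_introl eq_refl)), IH; [ring|].
  intros y Hy; apply H; right; exact Hy.
Qed.

Lemma tprod_upto e M : (length e - 1 <= M)%nat -> tprod N V e = vprod_upto M e.
Proof.
  intros HM; unfold tprod, vprod_upto.
  replace M with ((length e - 1) + (M - (length e - 1)))%nat by lia.
  rewrite seq_app, map_app, fold_Cmul_app,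
    (fold_Cmul_one _ (seq (1 + (length e - 1)) (M - (length e - 1)))); [ring|].
  intros j Hj; apply in_seq in Hj; rewrite nth_overflow by lia; reflexivity.
Qed.

Lemma vprod_upto_eadd M a b :
  vprod_upto M (eadd a b) = Cmul (vprod_upto M a) (vprod_upto M b).
Proof.
  unfold vprod_upto; induction (seq 1 M) as [|j l IH]; simpl; [ring|].
  rewrite IH, nth_eadd.
  assert (H : forall c m n, Cpow c (m + n) = Cmul (Cpow c m) (Cpow c n))
    by (intros c m n; induction m as [|m IHm]; simpl; [|rewrite IHm]; ring).
  rewrite H; ring.
Qed.

Lemma tprod_eadd a b : tprod N V (eadd a b) = Cmul (tprod N V a) (tprod N V b).
Proof.
  set (M := (length a + length b + length (eadd a b))%nat).
  rewrite !(tprod_upto _ M) by lia; apply vprod_upto_eadd.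
Qed.

Lemma tprod_strip : strip_invariant (tprod N V).
Proof.
  intros a b H; rewrite strip_eq_iff in H.
  set (M := (length a + length b)%nat); rewrite !(tprod_upto _ M) by lia.
  unfold vprod_upto; f_equal; apply map_ext; intros j; rewrite H; reflexivity.
Qed.

Lemma tprod_pv j : (1 <= j)%nat -> tprod N V (repeat 0%nat j ++ [1%nat]) = vtr N V j.
Proof.
  intros Hj; rewrite (tprod_upto _ j) by (rewrite length_app, repeat_length; simpl; lia).
  unfold vprod_upto; destruct j as [|j]; [lia|].
  rewrite seq_S, map_app, fold_Cmul_app, fold_Cmul_one.
  - cbn [map fold_right plus]; rewrite nth_pv, Nat.eqb_refl; unfold vtr; simpl; ring.
  - intros i Hi; apply in_seq in Hi; rewrite nth_pv.
    replace (Nat.eqb i (S j)) with false by (symmetry; apply Nat.eqb_neq; lia); reflexivity.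
Qed.

Lemma peval_lin p a b :
  peval N p V a b = lin (fun e => Cmul (tprod N V e) (mpow N V (nth 0 e 0%nat) a b)) p.
Proof. apply Csum_ext; intros; ring. Qed.

Lemma peval_peq p q a b : peq p q -> peval N p V a b = peval N q V a b.
Proof.
  intros H; rewrite !peval_lin; apply peq_lin; [exact H|].
  intros x y Hxy; rewrite (tprod_strip _ _ Hxy).
  rewrite strip_eq_iff in Hxy; rewrite Hxy; reflexivity.
Qed.

Lemma peval_padd p q a b :
  peval N (padd p q) V a b = Cadd (peval N p V a b) (peval N q V a b).
Proof. rewrite !peval_lin; apply lin_padd. Qed.

Lemma peval_pscale c p a b : peval N (pscale c p) V a b = Cmul c (peval N p V a b).
Proof. rewrite !peval_lin; apply lin_pscale. Qed.

Lemma peval_pu k a b : peval N (pu k) V a b = mpow N V k a b.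
Proof. unfold peval, pu, tprod; simpl; ring. Qed.

Lemma peval_psum {T} (f : T -> cpoly) l a b :
  peval N (psum (map f l)) V a b = (Sum (x in l) peval N (f x) V a b).
Proof.
  induction l as [|x l IH]; [reflexivity|].
  change (peval N (padd (f x) (psum (map f l))) V a b
          = Cadd (peval N (f x) V a b) (Sum (x in l) peval N (f x) V a b)).
  rewrite peval_padd, IH; reflexivity.
Qed.

(** Says that [p] evaluates to the scalar c, through its effect on products: this is the only
    multiplicativity of evaluation that is used, and it involves no matrix product. *)
Definition acts_as (p : cpoly) (c : C) : Prop :=
  forall q a b, peval N (pmul p q) V a b = Cmul c (peval N q V a b).

Lemma acts_as_pv j : (1 <= j)%nat -> acts_as (pv j) (vtr N V j).
Proof.
  intros Hj q a b; rewrite !peval_lin, lin_pmul; unfold pv; rewrite lin_term.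
  transitivity (lin (fun e => Cmul (vtr N V j)
    (Cmul (tprod N V e) (mpow N V (nth 0 e 0%nat) a b))) q).
  - transitivity (lin (fun e' => Cmul (tprod N V (eadd (repeat 0%nat j ++ [1%nat]) e'))
      (mpow N V (nth 0 (eadd (repeat 0%nat j ++ [1%nat]) e') 0%nat) a b)) q); [ring|].
    apply lin_ext; intros e; rewrite tprod_eadd, tprod_pv, nth_eadd, nth_pv by exact Hj.
    replace (Nat.eqb 0 j) with false by (symmetry; apply Nat.eqb_neq; lia).
    rewrite Nat.add_0_l; ring.
  - unfold lin; rewrite <- Csum_mul_l; apply Csum_ext; intros; ring.
Qed.

Lemma acts_as_padd p q c d : acts_as p c -> acts_as q d -> acts_as (padd p q) (Cadd c d).
Proof.
  intros Hp Hq r a b.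
  rewrite (peval_peq _ (padd (pmul p r) (pmul q r))) by ring.
  rewrite peval_padd, Hp, Hq; ring.
Qed.

Lemma acts_as_pmul p q c d : acts_as p c -> acts_as q d -> acts_as (pmul p q) (Cmul c d).
Proof.
  intros Hp Hq r a b.
  rewrite (peval_peq _ (pmul p (pmul q r))) by ring.
  rewrite Hp, Hq; ring.
Qed.

Lemma acts_as_pscale p c d : acts_as p d -> acts_as (pscale c p) (Cmul c d).
Proof.
  intros Hp r a b.
  rewrite (peval_peq _ (pscale c (pmul p r))) by (rewrite !pscale_pmul; ring).
  rewrite peval_pscale, Hp; ring.
Qed.

Lemma acts_as_psum {T} (f : T -> cpoly) (g : T -> C) l :
  (forall x, In x l -> acts_as (f x) (g x)) ->
  acts_as (psum (map f l)) (Sum (x in l) g x).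
Proof.
  intros H; induction l as [|x l IH]; simpl; [intros r a b; unfold peval; simpl; ring|].
  apply acts_as_padd; [apply H; left; reflexivity|].
  apply IH; intros y Hy; apply H; right; exact Hy.
Qed.

Lemma Csum_seq_1 (f : nat -> C) k : f 0%nat = C0 ->
  (Sum (m in seq 1 (k - 1)) f m) = (Sum (m in seq 0 k) f m).
Proof.
  intros H; destruct k as [|k]; [reflexivity|].
  simpl; rewrite H, Nat.sub_0_r; ring.
Qed.

Lemma acts_as_Dv j : (1 <= j)%nat -> acts_as (Dv j) (lap_tr N V j).
Proof.
  intros Hj; unfold Dv, lap_tr.
  apply acts_as_padd; apply acts_as_pscale; [apply acts_as_pv, Hj|].
  rewrite <- Csum_seq_1 by (apply C_ext; simpl; ring).
  apply acts_as_psum; intros m Hm; apply in_seq in Hm.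
  apply acts_as_pscale.
  replace (Cmul (vtr N V (j - m)) (vtr N V m))
    with (Cmul (vtr N V m) (vtr N V (j - m))) by ring.
  apply acts_as_pmul; apply acts_as_pv; lia.
Qed.

Lemma peval_Du k a b : peval N (Du k) V a b = lap_pow N V k a b.
Proof.
  unfold Du, lap_pow; rewrite peval_padd, !peval_pscale, peval_pu, peval_psum.
  rewrite <- Csum_seq_1 by (apply C_ext; simpl; ring).
  f_equal; f_equal; apply Csum_ext; intros m Hm; apply in_seq in Hm.
  rewrite peval_pscale, (peval_peq _ (pmul (pv (k - m)) (pu m))) by ring.
  rewrite acts_as_pv, peval_pu by lia; reflexivity.
Qed.

Lemma peval_mono k l a b : Forall (fun j => (1 <= j)%nat) l ->
  peval N (mono k l) V a b = meval N V k l a b.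
Proof.
  induction 1 as [|j l Hj _ IH]; simpl; [apply peval_pu|].
  rewrite acts_as_pv, IH by exact Hj; reflexivity.
Qed.

(** Puts the entries of p_N in the form whose first and second derivatives are [dmeval] and
    [ddmeval]. *)
Lemma peval_meval p a b :
  peval N p V a b
  = (Sum (t in p) Cmul (fst t) (meval N V (nth 0 (snd t) 0%nat) (gens (snd t)) a b)).
Proof.
  rewrite peval_lin; apply Csum_ext; intros t _; f_equal.
  transitivity (peval N [(C1, snd t)] V a b); [rewrite peval_lin, lin_term; ring|].
  rewrite (peval_peq _ _ a b (single_mono (snd t))); apply peval_mono, gens_pos.
Qed.

Lemma peval_mono_ext M p a b :
  peval N (mono_ext M p) V a b = (Sum (t in p) Cmul (fst t) (peval N (M (snd t)) V a b)).
Proof.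
  rewrite peval_lin, lin_mono_ext; apply Csum_ext; intros t _; rewrite peval_lin; reflexivity.
Qed.

End Evaluation.

(** * Second derivatives of trace monomials summed over the basis *)

Section LaplacianFormula.
Variables (N : nat) (B : list Mat).
Hypotheses (HN : (1 <= N)%nat) (HB : onb_uN N B).

(** The derivative of the product hits one factor at a time; contracted with the derivative of
    tr(V^j), the factor tr(V^i) yields j i tr(V^(i+j)) and V^k yields j k V^(j+k), each times -
    1/N^2. *)
Lemma basis_cross V j k l a b : (a < N)%nat -> (b < N)%nat -> (1 <= j)%nat ->
  Forall (fun i => (1 <= i)%nat) l ->
  (Sum (X in B) Cmul (dtr N X V j) (dmeval N X V k l a b))
  = Cmul (RtoC (- / (INR N * INR N))) (peval N (cross j k l) V a b).
Proof.
  intros Ha Hb Hj; induction 1 as [|i l Hi Hl IH]; simpl.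
  - rewrite basis_dtr_dpow, peval_pscale, peval_pu by assumption; reflexivity.
  - rewrite (Csum_ext _ (fun X => Cadd
      (Cmul (meval N V k l a b) (Cmul (dtr N X V j) (dtr N X V i)))
      (Cmul (vtr N V i) (Cmul (dtr N X V j) (dmeval N X V k l a b)))))
      by (intros; ring).
    rewrite Csum_add, !Csum_mul_l, IH, basis_dtr_dtr by assumption.
    rewrite peval_padd, peval_pscale, !acts_as_pv, peval_mono by (assumption || lia); ring.
Qed.

(** For a factor tr(V^j) times the rest: both derivatives on the trace give [Dv j], one on each
    gives twice [cross], and both on the rest is the induction hypothesis, matching the recursions
    of [Dmono] and [Lmono]. *)
Lemma basis_ddmeval V k l a b : (a < N)%nat -> (b < N)%nat ->
  Forall (fun i => (1 <= i)%nat) l ->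
  (Sum (X in B) ddmeval N X V k l a b)
  = Cadd (peval N (Dmono k l) V a b)
         (Cmul (RtoC (- / (INR N * INR N))) (peval N (Lmono k l) V a b)).
Proof.
  intros Ha Hb; induction 1 as [|j l Hj Hl IH]; simpl.
  - rewrite basis_ddpow, peval_Du by assumption; unfold peval at 1; simpl; ring.
  - rewrite (Csum_ext _ (fun X => Cadd (Cadd
      (Cmul (meval N V k l a b) (ddtr N X V j))
      (Cmul (RtoC 2) (Cmul (dtr N X V j) (dmeval N X V k l a b))))
      (Cmul (vtr N V j) (ddmeval N X V k l a b))))
      by (intros; apply C_ext; simpl; ring).
    rewrite !Csum_add, !Csum_mul_l, IH, basis_ddtr, basis_cross by assumption.
    rewrite !peval_padd, peval_pscale, !acts_as_pv, (acts_as_Dv N V j Hj), peval_mono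
      by assumption; ring.
Qed.

Lemma Laplacian_peval p U a b : (a < N)%nat -> (b < N)%nat ->
  Laplacian N B (peval N p) U a b = peval N (DN N opD opL p) U a b.
Proof.
  intros Ha Hb; unfold Laplacian.
  (* [Xtilde] takes a function, so p_N is rewritten at all matrices and not only at [U]. *)
  rewrite (functional_extensionality _ _ (fun V => peval_meval N V p a b)).
  rewrite (Csum_ext _ (fun X => Sum (t in p) Cmul (fst t)
    (ddmeval N X U (nth 0 (snd t) 0%nat) (gens (snd t)) a b))).
  - rewrite Csum_exchange; unfold DN, opD, opL.
    rewrite peval_padd, peval_pscale, !peval_mono_ext, <- Csum_mul_l, <- Csum_add.
    apply Csum_ext; intros [c e] _; cbn [fst snd].
    rewrite Csum_mul_l, basis_ddmeval by (assumption || apply gens_pos); ring.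
  - intros X _.
    pose (dF := fun V => Sum (t in p) Cmul (fst t)
      (dmeval N X V (nth 0 (snd t) 0%nat) (gens (snd t)) a b)).
    rewrite (Xtilde_dir N X (fun V => Sum (t in p) Cmul (fst t)
      (meval N V (nth 0 (snd t) 0%nat) (gens (snd t)) a b)) dF).
    + rewrite (Xtilde_dir N X dF (fun V => Sum (t in p) Cmul (fst t)
        (ddmeval N X V (nth 0 (snd t) 0%nat) (gens (snd t)) a b))); [reflexivity|].
      apply is_dir_sum; intros t _; apply is_dir_scale, is_mdir_dmeval; assumption.
    + apply is_dir_sum; intros t _; apply is_dir_scale, is_mdir_meval; assumption.
Qed.

End LaplacianFormula.

Theorem mainTheorem10 :
  exists D L : cpoly -> cpoly,
    plinear D /\ plinear L /\
    (forall (N : nat), (1 <= N)%nat ->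
       forall (B : list Mat), onb_uN N B ->
       forall (p : cpoly) (U : Mat), unitary N U ->
       forall i j, (i < N)%nat -> (j < N)%nat ->
         Laplacian N B (peval N p) U i j = peval N (DN N D L p) U i j) /\
    D_props D /\
    (forall D' : cpoly -> cpoly, plinear D' -> D_props D' -> forall p, peq (D' p) (D p)).
Proof.
  exists opD, opL.
  split; [exact plinear_opD|]; split; [exact plinear_opL|].
  split; [|split; [exact opD_props|exact D_props_unique]].
  intros N HN B HB p U _ i j Hi Hj; apply Laplacian_peval; assumption.
Qed.
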